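(* Let $M$ be a smooth manifold, $\{\cdot,\cdot\}$ a generalized Poisson bracket on $M$ with bundle map $J:T^*M\to TM$, $\Delta\subset TM$ a smooth vector subbundle, and $\mathcal D$ the Dirac structure with fibers $\mathcal D(x)=\{(v,v^* )\in T_xM\times T_x^*M\mid v-J(x)v^*\in\Delta(x),\ v^*\in\Delta^\circ(x)\}$. Let $G$ be a Lie group with Lie algebra $\mathfrak g$ acting smoothly on $M$ such that for all $\xi\in\mathfrak g$: $L_{\xi_M}J=0$, and $L_{\xi_M}Z$ is a local section of $\Delta$ whenever $Z$ is. Let $P:M\to\mathfrak g^*$ be an $Ad^*$-equivariant momentum map, i.e. $(\xi_M,dP_\xi)$ is a section of $\mathcal D$ for all $\xi\in\mathfrak g$. Assume that $V+\Delta$ has constant dimension on $M$, where $V(x)=\mathrm{span}\{\xi_M(x)\mid\xi\in\mathfrak g\}$. Suppose that $0$ is a regular value of $P$ and that $G$ acts regularly on $M$ (that is, $M/G$ is a smooth manifold and $M\to M/G$ is a surjective submersion), so that $M_0=P^{-1}(0)/G$ is a smooth manifold, and suppose that the constant-dimension conditions of regular reduction listed in the context hold, so that the regular reduced Dirac structure $\hat{\mathcal D}$ on $M_0$ is defined. Then the singular reduced Dirac structure $(\{\cdot,\cdot\}_0,\hat\Delta)$ defines a Dirac structure $\mathcal D_0$ on the manifold $M_0$, with local sections $$\{(\hat X,\hat\alpha)\in\mathfrak X_{loc}(M_0)\oplus\Omega^1_{loc}(M_0)\mid \hat X-J_0\hat\alpha\in\Gamma_{loc}(\hat\Delta),\ \hat\alpha\in\Gamma_{loc}(\hat\Delta^\circ)\},$$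 and $\hat{\mathcal D}=\mathcal D_0$.
   Context: All objects are smooth. A generalized Poisson bracket on $M$ is a skew-symmetric bilinear map $\{\cdot,\cdot\}:C^\infty(M)\times C^\infty(M)\to C^\infty(M)$ satisfying the Leibniz rule (no Jacobi identity or nondegeneracy required); $J:T^*M\to TM$ is the skew-symmetric bundle map with $\langle df,J\,dh\rangle=\{f,h\}$. A Dirac structure on a manifold $M$ is a vector subbundle $\mathcal D\subset TM\oplus T^*M$ equal to its own orthogonal complement under the pairing $\langle\langle(v,v^* ),(w,w^* )\rangle\rangle=\langle v^*,w\rangle+\langle w^*,v\rangle$. $\Delta^\circ$ is the annihilator of $\Delta$; $\mathfrak X_{loc}$, $\Omega^1_{loc}$, $\Gamma_{loc}(\cdot)$ denote local vector fields, local one-forms, local sections. $\xi_M$ is the infinitesimal generator of $\xi\in\mathfrak g$, and $P_\xi(x)=\langle P(x),\xi\rangle$. Write $N=P^{-1}(0)$ (a closed submanifold, as $0$ is a regular value), $\iota:N\hookrightarrow M$ for the inclusion, $\pi:N\to M_0=N/G$ for the projection. Regular reduction conditions: (i) $\mathcal D(x)\cap(T_xN\times T_x^*M)$ has constant dimension for $x\in N$, so that the restricted Dirac structure $\mathcal D_N$ on $N$, with fibers $\mathcal D_N(x)=\{(v,v^*|_{T_xN})\mid (v,v^* )\in\mathcal D(x),\ v\in T_xN\}$, is defined; (ii) for $\mathcal D_N$ on $N$ with the action of $G$: $\ker T\pi+\Delta_N$ is a smooth subbundle of $TN$, where $\Delta_N(x)=\{X(x)\mid (X,0)\text{ is a local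 section of }\mathcal D_N\}$, and $\mathcal D_N\cap E_N$ is a smooth subbundle of $TN\oplus T^*N$, where $E_N$ is the subbundle whose local sections are the $(X,\alpha)$ with $\alpha=\pi^*\hat\alpha$ for some $\hat\alpha\in\Omega^1_{loc}(M_0)$. Regular reduced Dirac structure: $\hat{\mathcal D}$ on $M_0$ is the Dirac structure whose local sections are the pairs $(\hat X,\hat\alpha)\in\mathfrak X_{loc}(M_0)\oplus\Omega^1_{loc}(M_0)$ for which there is a local section $(X,\alpha)$ of $\mathcal D$ such that $X$ is tangent to $N$, $X|_N$ is $\pi$-related to $\hat X$, and $\iota^*\alpha=\pi^*\hat\alpha$. Singular reduced Dirac structure: $C^\infty(M_0)$ is the set of continuous $f_0$ on $M_0$ for which there is $f\in C^\infty(M)^G$ with $f_0\circ\pi=f|_N$; in the present regular case this is taken to be the usual set of smooth functions on the manifold $M_0$. The bracket $\{\cdot,\cdot\}_0$ is defined by $\{f_0,h_0\}_0\circ\pi=\{f,h\}|_N$ for such extensions $f,h$; $J_0:T^*M_0\to TM_0$ is the skew-symmetric bundle map with $\langle df_0,J_0\,dh_0\rangle=\{f_0,h_0\}_0$. A (local) vector field $X$ on $M$ projects to $M_0$ if there is a derivation $\hat X$ on $C^\infty(M_0)$ with $X[f](x)=\hat X[f_0](\pi(x))$ for all $x\in N$ (in the domain of $X$) and all $f\in C^\infty(M)^G$, where $f_0\circ\pi=f|_N$. $\hat\Delta$ is the vector space of derivations (here: the distribution of vector fields on $M_0$) locally spanned by the projections $\hat X_1,\dots,\hat X_m$ of a local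 basis $X_1,\dots,X_m$ of sections of $\Delta$ consisting of vector fields that project to $M_0$ (the construction uses the existence of such bases, under the assumption that $V+\Delta$ has constant dimension). The singular reduced Dirac structure is the pair $(\{\cdot,\cdot\}_0,\hat\Delta)$. *)

(* Defs.v *)
From HB Require Import structures.
From mathcomp Require Import all_boot all_order all_algebra.
From mathcomp Require Import all_classical all_reals all_analysis.

Set Implicit Arguments.
Unset Strict Implicit.
Unset Printing Implicit Defensive.

Import Order.TTheory GRing.Theory Num.Theory.
Import numFieldNormedType.Exports.

Local Open Scope classical_set_scope.
Local Open Scope ring_scope.

Fixpoint Ck_on (R : realType) (n k : nat) (O : set 'rV[R]_n)
    (f : 'rV[R]_n -> R) : Prop :=
  match k with
  | 0 => forall u, O u -> {for u, continuous f}
  | k'.+1 => (forall u, O u -> differentiable f u) /\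
             (forall w : 'rV[R]_n, Ck_on k' O ('D_w f))
  end.

Definition Cinf_on (R : realType) (n : nat) (O : set 'rV[R]_n)
    (f : 'rV[R]_n -> R) : Prop := forall k, Ck_on k O f.

(* [cmap] and [cinv] are total functions, meaningful on [cdom] and on
   [cmap @` cdom] only. *)
Record chart (R : realType) (T : Type) (n : nat) := Chart {
  cdom : set T;
  cmap : T -> 'rV[R]_n;
  cinv : 'rV[R]_n -> T }.

(* No axiom on the charts yet: products are formed at this level. *)
Record charted (R : realType) := Charted {
  ctop :> topologicalType;
  cdim : nat;
  atlas : set (chart R ctop cdim) }.

Definition is_chart (R : realType) (T : topologicalType) (n : nat)
    (c : chart R T n) : Prop :=
  [/\ open (cdom c), open (cmap c @` cdom c),
      (forall x, cdom c x -> cinv c (cmap c x) = x),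
      {within cdom c, continuous (cmap c)} &
      {within cmap c @` cdom c, continuous (cinv c)}].

Definition compatible (R : realType) (T : Type) (n : nat)
    (c d : chart R T n) : Prop :=
  forall j, Cinf_on (cmap c @` (cdom c `&` cdom d))
                    (fun u => cmap d (cinv c u) 0 j).

Definition is_manifold (R : realType) (M : charted R) : Prop :=
  [/\ hausdorff_space M, @second_countable M,
      (forall c : chart R M (cdim M), atlas c -> is_chart c),
      (forall x : M, exists2 c, @atlas R M c & cdom c x) &
      (forall c d : chart R M (cdim M),
         atlas c -> atlas d -> compatible c d)].

Record manifold (R : realType) := Manifold {
  mspace :> charted R;
  manifoldP : is_manifold mspace }.

Definition prod_chart (R : realType) (T T' : Type) (n n' : nat)
    (c : chart R T n) (d : chart R T' n') : chart R (T * T') (n + n') :=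
  Chart (cdom c `*` cdom d)
        (fun p => row_mx (cmap c p.1) (cmap d p.2))
        (fun u => (cinv c (lsubmx u), cinv d (rsubmx u))).

Definition prod_charted (R : realType) (M N : charted R) : charted R :=
  @Charted R (M * N)%type (cdim M + cdim N)
    [set prod_chart c d | c in @atlas R M & d in @atlas R N].

Definition smooth_on (R : realType) (M : charted R) (U : set M)
    (f : M -> R) : Prop :=
  forall c : chart R M (cdim M), atlas c ->
    Cinf_on (cmap c @` (cdom c `&` U)) (f \o cinv c).

Definition smooth (R : realType) (M : charted R) (f : M -> R) : Prop :=
  smooth_on setT f.

Definition smooth_near (R : realType) (M : charted R) (x : M)
    (f : M -> R) : Prop :=
  exists U : set M, [/\ open U, U x & smooth_on U f].

Definition smooth_map (R : realType) (M N : charted R) (F : M -> N) : Prop :=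
  continuous F /\
  forall d : chart R N (cdim N), atlas d ->
    forall j, smooth_on (F @^-1` cdom d) (fun x => cmap d (F x) 0 j).

(* A tangent vector at [x] is a directional derivative at [x] in a chart,
   acting on the functions [M -> R] that are smooth near [x].  It is given the
   value 0 on all other functions, so that equality of tangent vectors is
   equality of functions, and [tangent x] is a linear subspace of [tvec M].
   In the same way a covector at [x] is extended by 0 outside [tangent x]. *)
Definition tvec (R : realType) (M : charted R) : lmodType R := (M -> R) -> R.
Definition cvec (R : realType) (M : charted R) : lmodType R := tvec M -> R.

Definition tangent (R : realType) (M : charted R) (x : M) : set (tvec M) :=
  [set v | exists (c : chart R M (cdim M)) (u : 'rV[R]_(cdim M)),
     [/\ atlas c, cdom c x &
         v = fun f => if `[< smooth_near x f >]
                      then 'D_u (f \o cinv c) (cmap c x) else 0]].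

Definition cotangent (R : realType) (M : charted R) (x : M) : set (cvec M) :=
  [set a | (forall (k : R) (v w : tvec M), tangent x v -> tangent x w ->
              a (k *: v + w) = k * a v + a w) /\
           (forall v, ~ tangent x v -> a v = 0)].

Definition tmap (R : realType) (M N : charted R) (F : M -> N) (x : M)
    (v : tvec M) : tvec N :=
  fun f => if `[< smooth_near (F x) f >] then v (f \o F) else 0.

Definition cpull (R : realType) (M N : charted R) (F : M -> N) (x : M)
    (a : cvec N) : cvec M :=
  fun v => if `[< tangent x v >] then a (tmap F x v) else 0.

Definition differential (R : realType) (M : charted R) (f : M -> R) (x : M) :
    cvec M :=
  fun v => if `[< tangent x v >] then v f else 0.

Definition submersion (R : realType) (M N : charted R) (F : M -> N) : Prop :=
  smooth_map F /\
  forall x (w : tvec N), tangent (F x) w ->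
    exists2 v, tangent x v & tmap F x v = w.

Definition embedding (R : realType) (M N : charted R) (F : M -> N) : Prop :=
  [/\ smooth_map F, injective F,
      (forall x (v w : tvec M), tangent x v -> tangent x w ->
         tmap F x v = tmap F x w -> v = w) &
      (forall U : set M, open U ->
         exists2 W : set N, open W & U = F @^-1` W)].

Definition vfield (R : realType) (M : charted R) (U : set M)
    (X : M -> tvec M) : Prop :=
  (forall x, U x -> tangent x (X x)) /\
  (forall W f, open W -> smooth_on W f ->
     smooth_on (U `&` W) (fun x => X x f)).

Definition oneform (R : realType) (M : charted R) (U : set M)
    (a : M -> cvec M) : Prop :=
  (forall x, U x -> cotangent x (a x)) /\
  (forall W X, open W -> W `<=` U -> vfield W X ->
     smooth_on W (fun x => a x (X x))).

Definition pfield (R : realType) (M : charted R) (U : set M)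
    (s : M -> (tvec M * cvec M)%type) : Prop :=
  vfield U (fun x => (s x).1) /\ oneform U (fun x => (s x).2).

Definition lie_bracket (R : realType) (M : charted R) (X Y : M -> tvec M)
    (x : M) : tvec M :=
  fun f => if `[< smooth_near x f >]
           then X x (fun y => Y y f) - Y x (fun y => X y f) else 0.

(* [g] is the Lie derivative [L_X a] on [U]:
   [<L_X a, Y> = X[<a, Y>] - <a, [X, Y]>]. *)
Definition is_lie_form (R : realType) (M : charted R) (X : M -> tvec M)
    (U : set M) (a g : M -> cvec M) : Prop :=
  oneform U g /\
  forall W Y, open W -> W `<=` U -> vfield W Y ->
    forall x, W x ->
      g x (Y x) = X x (fun y => a y (Y y)) - a x (lie_bracket X Y x).

Definition lspan (R : realType) (V : lmodType R) (S : set V) : set V :=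
  [set v | exists r (c : 'I_r -> R) (e : 'I_r -> V),
     (forall i, S (e i)) /\ v = \sum_i c i *: e i].

Definition frame (R : realType) (V : lmodType R) (r : nat) (e : 'I_r -> V)
    (S : set V) : Prop :=
  (forall c : 'I_r -> R, \sum_i c i *: e i = 0 -> forall i, c i = 0) /\
  S = lspan (range e).

Definition has_dim (R : realType) (V : lmodType R) (S : set V) (d : nat) :
    Prop :=
  exists e : 'I_d -> V, frame e S.

Definition const_dim (R : realType) (V : lmodType R) (T : Type)
    (S : T -> set V) : Prop :=
  exists d, forall x, has_dim (S x) d.

Definition set_add (R : realType) (V : lmodType R) (A B : set V) : set V :=
  [set v + w | v in A & w in B].

(* [fld] is the predicate of being a local section of the ambient bundle:
   [vfield] for [TM], [pfield] for [TM (+) T*M]. *)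
Definition is_section (T V : Type) (fld : set T -> (T -> V) -> Prop)
    (S : T -> set V) (U : set T) (s : T -> V) : Prop :=
  fld U s /\ forall x, U x -> S x (s x).

Definition subbundle (R : realType) (T : topologicalType) (V : lmodType R)
    (fld : set T -> (T -> V) -> Prop) (S : T -> set V) : Prop :=
  forall x, exists (U : set T) (r : nat) (s : 'I_r -> T -> V),
    [/\ open U, U x, (forall i, fld U (s i)) &
        forall y, U y -> frame (fun i => s i y) (S y)].

Definition annihilator (R : realType) (M : charted R)
    (Delta : M -> set (tvec M)) (x : M) : set (cvec M) :=
  [set a | cotangent x a /\ forall v, Delta x v -> a v = 0].

(* Only the values of [br] on smooth functions are meaningful. *)
Definition gen_poisson (R : realType) (M : charted R)
    (br : (M -> R) -> (M -> R) -> M -> R) : Prop :=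
  [/\ (forall f h, smooth f -> smooth h -> smooth (br f h)),
      (forall f h, smooth f -> smooth h -> forall x, br f h x = - br h f x),
      (forall (k : R) f g h, smooth f -> smooth g -> smooth h ->
         forall x, br (fun y => k * f y + g y) h x = k * br f h x + br g h x) &
      (forall f g h, smooth f -> smooth g -> smooth h ->
         forall x, br (fun y => f y * g y) h x
                   = f x * br g h x + g x * br f h x)].

Definition skew_bundle_map (R : realType) (M : charted R)
    (J : M -> cvec M -> tvec M) : Prop :=
  [/\ (forall x a, cotangent x a -> tangent x (J x a)),
      (forall x (k : R) (a b : cvec M), cotangent x a -> cotangent x b ->
         J x (k *: a + b) = k *: J x a + J x b),
      (forall x a b, cotangent x a -> cotangent x b ->
         a (J x b) = - b (J x a)) &
      (forall (U : set M) a, open U -> oneform U a ->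
         vfield U (fun x => J x (a x)))].

Definition bundle_map_of (R : realType) (M : charted R)
    (br : (M -> R) -> (M -> R) -> M -> R) (J : M -> cvec M -> tvec M) : Prop :=
  skew_bundle_map J /\
  forall f h, smooth f -> smooth h -> forall x,
    differential f x (J x (differential h x)) = br f h x.

Definition orthogonal (R : realType) (M : charted R) (x : M)
    (S : set (tvec M * cvec M)%type) : set (tvec M * cvec M)%type :=
  [set p | [/\ tangent x p.1, cotangent x p.2 &
               forall q, S q -> p.2 q.1 + q.2 p.1 = 0]].

Definition dirac_structure (R : realType) (M : charted R)
    (D : M -> set (tvec M * cvec M)%type) : Prop :=
  subbundle (@pfield R M) D /\ forall x, D x = orthogonal x (D x).

Definition dirac_of (R : realType) (M : charted R)
    (J : M -> cvec M -> tvec M) (Delta : M -> set (tvec M)) (x : M) :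
    set (tvec M * cvec M)%type :=
  [set p | [/\ tangent x p.1, cotangent x p.2,
               Delta x (p.1 - J x p.2) & annihilator Delta x p.2]].

Record lieGroup (R : realType) := LieGroup {
  lgspace :> manifold R;
  lmul : lgspace -> lgspace -> lgspace;
  lone : lgspace;
  linv : lgspace -> lgspace;
  lmulA : forall a b c, lmul a (lmul b c) = lmul (lmul a b) c;
  lmul1 : forall a, lmul lone a = a;
  lmulV : forall a, lmul (linv a) a = lone;
  lmul_smooth : smooth_map (M := prod_charted lgspace lgspace) (N := lgspace)
                  (fun p => lmul p.1 p.2);
  linv_smooth : smooth_map linv }.

Definition smooth_action (R : realType) (G : lieGroup R) (M : charted R)
    (act : G -> M -> M) : Prop :=
  [/\ (forall x, act (lone G) x = x),
      (forall a b x, act (lmul a b) x = act a (act b x)) &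
      smooth_map (M := prod_charted G M) (N := M) (fun p => act p.1 p.2)].

Definition lie_alg (R : realType) (G : lieGroup R) : set (tvec G) :=
  tangent (lone G).

Definition lie_coalg (R : realType) (G : lieGroup R) : set (cvec G) :=
  cotangent (lone G).

Definition Ad (R : realType) (G : lieGroup R) (g : G) (xi : tvec G) : tvec G :=
  tmap (fun h => lmul (lmul g h) (linv g)) (lone G) xi.

(* The infinitesimal generator [xi_M] at [x]: the velocity at the unit of
   [g |-> g x] in the direction [xi]. *)
Definition generator (R : realType) (G : lieGroup R) (M : charted R)
    (act : G -> M -> M) (xi : tvec G) (x : M) : tvec M :=
  tmap (fun g => act g x) (lone G) xi.

Definition vertical (R : realType) (G : lieGroup R) (M : charted R)
    (act : G -> M -> M) (x : M) : set (tvec M) :=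
  lspan [set generator act xi x | xi in @lie_alg R G].

(* [L_X J = 0], where [(L_X J) a = L_X (J a) - J (L_X a)]. *)
Definition lie_invariant_map (R : realType) (M : charted R) (X : M -> tvec M)
    (J : M -> cvec M -> tvec M) : Prop :=
  forall (U : set M) a g, open U -> oneform U a -> is_lie_form X U a g ->
    forall x, U x -> lie_bracket X (fun y => J y (a y)) x = J x (g x).

Definition lie_invariant_dist (R : realType) (M : charted R)
    (X : M -> tvec M) (Delta : M -> set (tvec M)) : Prop :=
  forall (U : set M) Z, open U -> is_section (@vfield R M) Delta U Z ->
    is_section (@vfield R M) Delta U (lie_bracket X Z).

Definition symmetry (R : realType) (G : lieGroup R) (M : charted R)
    (act : G -> M -> M) (J : M -> cvec M -> tvec M)
    (Delta : M -> set (tvec M)) : Prop :=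
  forall xi, lie_alg xi ->
    lie_invariant_map (generator act xi) J /\
    lie_invariant_dist (generator act xi) Delta.

(* [P x xi] is [P_xi (x)]. *)
Definition momentum_map (R : realType) (G : lieGroup R) (M : charted R)
    (act : G -> M -> M) (D : M -> set (tvec M * cvec M)%type)
    (P : M -> cvec G) : Prop :=
  [/\ (forall x, lie_coalg (P x)),
      (forall xi, lie_alg xi -> smooth (fun x => P x xi)),
      (forall g x xi, lie_alg xi ->
         P (act g x) xi = P x (Ad (linv g) xi)) &
      (forall xi, lie_alg xi ->
         is_section (@pfield R M) D setT
           (fun x => (generator act xi x,
                      differential (fun y => P y xi) x)))].

(* [T_x P] is onto [g^*] at every [x] in [P^-1(0)]; the tangent spaces of the
   vector space [g^*] are identified with [g^*]. *)
Definition zero_regular_value (R : realType) (G : lieGroup R) (M : charted R)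
    (P : M -> cvec G) : Prop :=
  forall x, P x = 0 -> forall mu, lie_coalg mu ->
    exists2 v, tangent x v &
      forall xi, lie_alg xi -> v (fun y => P y xi) = mu xi.

(* [q] exhibits [Q] as the quotient of [S] by the equivalence relation
   [same_orbit]; a surjective submersion determines the topology and the
   smooth structure of its target. *)
Definition smooth_quotient (R : realType) (S Q : charted R)
    (same_orbit : S -> S -> Prop) (q : S -> Q) : Prop :=
  [/\ submersion q, (forall y, exists x, q x = y) &
      forall x x', q x = q x' <-> same_orbit x x'].

Definition regular_action (R : realType) (G : lieGroup R) (M : charted R)
    (act : G -> M -> M) : Prop :=
  exists (Q : manifold R) (q : M -> Q),
    smooth_quotient (fun x x' => exists g, x' = act g x) q.

(* [N] with [i] is the level set [P^-1(0)] of the regular value [0], as an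
   embedded submanifold of codimension [dim G] (no dimension is imposed when
   the level set is empty). *)
Definition zero_level (R : realType) (G : lieGroup R) (M N : charted R)
    (P : M -> cvec G) (i : N -> M) : Prop :=
  [/\ embedding i, range i = [set x | P x = 0] &
      forall z : N, cdim M = (cdim N + cdim G)%N].

Section Reduction.
Variables (R : realType) (G : lieGroup R) (M N M0 : charted R).
Variables (act : G -> M -> M) (i : N -> M) (p : N -> M0).

(* [T_zN] is identified with its image under [tmap i z]. *)
Definition tangent_part (D : M -> set (tvec M * cvec M)%type) (z : N) :
    set (tvec M * cvec M)%type :=
  [set q | D (i z) q /\ exists2 w, tangent z w & q.1 = tmap i z w].

Definition restricted_dirac (D : M -> set (tvec M * cvec M)%type) (z : N) :
    set (tvec N * cvec N)%type :=
  [set q | exists2 a, D (i z) (tmap i z q.1, a) &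
             tangent z q.1 /\ q.2 = cpull i z a].

Definition vertical_kernel (z : N) : set (tvec N) :=
  [set w | tangent z w /\ tmap p z w = 0].

Definition characteristic (DN : N -> set (tvec N * cvec N)%type) (z : N) :
    set (tvec N) :=
  [set w | exists (U : set N) X,
     [/\ open U, U z,
         is_section (@pfield R N) DN U (fun y => (X y, 0 : cvec N)) &
         w = X z]].

(* Fibers of [E_N]: values at [z] of the local pairs [(X, p^* a0)]. *)
Definition basic_bundle (z : N) : set (tvec N * cvec N)%type :=
  [set q | exists (U : set N) (W : set M0) X a0,
     [/\ open U, U z, vfield U X &
         [/\ open W, p @` U `<=` W, oneform W a0 &
             q = (X z, cpull p z (a0 (p z)))]]].

Definition regular_conditions (D : M -> set (tvec M * cvec M)%type) : Prop :=
  let DN := restricted_dirac D in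
  [/\ const_dim (tangent_part D),
      subbundle (@vfield R N)
        (fun z => set_add (vertical_kernel z) (characteristic DN z)) &
      subbundle (@pfield R N) (fun z => DN z `&` basic_bundle z)].

(* Around each point [y] of [W] the pair [(X0, a0)] comes from a local section
   [(X, a)] of [D] defined on an open set [U] meeting the fiber over [y]. *)
Definition lifts (D : M -> set (tvec M * cvec M)%type) (W : set M0)
    (X0 : M0 -> tvec M0) (a0 : M0 -> cvec M0) : Prop :=
  forall y, W y -> exists (U : set M) X a,
    [/\ open U, (exists2 z, U (i z) & p z = y),
        is_section (@pfield R M) D U (fun x => (X x, a x)) &
        forall z, U (i z) -> W (p z) ->
          (exists w, [/\ tangent z w, tmap i z w = X (i z) &
                         tmap p z w = X0 (p z)]) /\
          cpull i z (a (i z)) = cpull p z (a0 (p z))].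

Definition regular_reduced (D : M -> set (tvec M * cvec M)%type)
    (Dhat : M0 -> set (tvec M0 * cvec M0)%type) : Prop :=
  dirac_structure Dhat /\
  forall (W : set M0) X0 a0, open W -> vfield W X0 -> oneform W a0 ->
    (is_section (@pfield R M0) Dhat W (fun y => (X0 y, a0 y)) <->
     lifts D W X0 a0).

Definition invariant_fun (f : M -> R) : Prop :=
  forall g x, f (act g x) = f x.

Definition induces (f : M -> R) (f0 : M0 -> R) : Prop :=
  [/\ smooth f, invariant_fun f & forall z, f0 (p z) = f (i z)].

Definition singular_Cinf (f0 : M0 -> R) : Prop :=
  continuous f0 /\ exists f, induces f f0.

Definition reduced_bracket (br : (M -> R) -> (M -> R) -> M -> R)
    (br0 : (M0 -> R) -> (M0 -> R) -> M0 -> R) : Prop :=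
  gen_poisson br0 /\
  forall f0 h0 f h, singular_Cinf f0 -> singular_Cinf h0 ->
    induces f f0 -> induces h h0 ->
    forall z, br0 f0 h0 (p z) = br f h (i z).

Definition projects (U : set M) (X : M -> tvec M) (W : set M0)
    (X0 : M0 -> tvec M0) : Prop :=
  [/\ vfield U X, vfield W X0 &
      forall z, U (i z) -> W (p z) /\
        forall f f0, singular_Cinf f0 -> induces f f0 ->
          X (i z) f = X0 (p z) f0].

Definition reduced_distribution (Delta : M -> set (tvec M))
    (Delta0 : M0 -> set (tvec M0)) : Prop :=
  forall z, exists (U : set M) (W : set M0) (m : nat)
      (X : 'I_m -> M -> tvec M) (X0 : 'I_m -> M0 -> tvec M0),
    [/\ open U, U (i z), open W &
        [/\ (forall x, U x -> frame (fun k => X k x) (Delta x)),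
            (forall k, projects U (X k) W (X0 k)) &
            forall z', U (i z') ->
              Delta0 (p z') = lspan (range (fun k => X0 k (p z')))]].

End Reduction.

(* Main.v *)
Require Import Defs.
From HB Require Import structures.
From mathcomp Require Import all_boot all_order all_algebra.
From mathcomp Require Import all_classical all_reals all_analysis.
From mathcomp Require Import ring.

(** The regular reduced structure is its own orthogonal, so it is enough to show
    that it is contained, fiber by fiber, in the isotropic [dirac_of J0 Delta0]:
    the two are then equal, and the latter is a Dirac structure because the
    former is.

    For the inclusion, let [(X, a)] be a section of [D] over [x = i z] lifting
    [(X0, a0)].  A dimension count gives [T_xN = ker T_xP] and shows that the
    annihilator of [T_xN] consists of the [dP_xi(x)].  As [dP_xi] annihilates
    [Delta], the projectable frame of [Delta] is tangent to [N], whence [a0]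
    annihilates [Delta0].  Write [a0 = sum_k lam_k dh0_k] with global functions
    [h0_k], extended to invariant functions [h_k], and
    [b = sum_k lam_k dh_k(x)].  Then [a - b] vanishes on [T_xN], so it is some
    [dP_xi], and [J (a - b)] is [xi_M] up to [Delta].  Since [xi_M] kills
    invariant functions, [X0 - J0 a0] and the projection of an element of
    [Delta] agree on all smooth functions of [M0]. *)

Set Implicit Arguments.
Unset Strict Implicit.
Unset Printing Implicit Defensive.

Import Order.TTheory GRing.Theory Num.Theory.
Import numFieldNormedType.Exports.

Local Open Scope classical_set_scope.
Local Open Scope ring_scope.

(** The first-order expansion of [f] at [x] is also one of [g], and uniqueness of the differential
    makes its linear part ['d g x]. *)
Lemma near_eq_differentiable (R : realType) (V W : normedModType R)
    (f g : V -> W) (x : V) :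
  (\near x, f x = g x) -> differentiable f x -> differentiable g x.
Proof.
move=> fg /diff_locallyP[df /eqaddoP fo].
have go : g \o shift x = cst (g x) + 'd f x +o_ 0 id.
  have fg0 : \forall h \near (0 : V), f (h + x) = g (h + x).
    by move: (fg); rewrite (near_shift 0 x) subr0.
  apply/eqaddoP => e e0; apply: filterS2 fg0 (fo _ e0) => h fgh.
  by rewrite !fctE /= fgh (nbhs_singleton fg).
by apply/diff_locallyP; rewrite (diff_unique df go).
Qed.

Lemma diff_coord (R : realType) n (j : 'I_n) (u w : 'rV[R]_n) :
  'd (fun v : 'rV[R]_n => v 0 j : R) u w = w 0 j.
Proof.
have @f : {linear 'rV[R]_n -> R}.
  by exists (fun v : 'rV[R]_n => v 0 j); do 2![eexists]; do ?[constructor];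
     rewrite ?mxE// => ? *; rewrite ?mxE//; move=> ?; rewrite !mxE.
by rewrite -[LHS]/('d f u w) diff_lin //; exact: coord_continuous.
Qed.

(** * Functions of class C^k *)

Section Ck.
Context {R : realType} {n : nat}.
Implicit Types (O V : set 'rV[R]_n) (f g : 'rV[R]_n -> R) (k : nat).

Lemma Ck_onW k O f : Ck_on k.+1 O f -> Ck_on k O f.
Proof.
elim: k f => [|k IH] f [df Df].
  by move=> u Ou; exact/differentiable_continuous/df.
by split=> // w; exact/IH/Df.
Qed.

Lemma Ck_onS k O V f : V `<=` O -> Ck_on k O f -> Ck_on k V f.
Proof.
elim: k f => [|k IH] f VO /=; first by move=> cf u /VO/cf.
by move=> [df Df]; split=> [u /VO/df//|w]; exact/IH/Df.
Qed.

(** Values and directional derivatives at a point depend only on the germ there. Gluing and changing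
    charts both rest on this, since [cmap] and [cinv] are meaningful only on open pieces. *)
Lemma Ck_on_local k O f :
  (forall u, O u -> exists V g,
     [/\ open V, V u, Ck_on k V g & forall v, V v -> f v = g v]) ->
  Ck_on k O f.
Proof.
elim: k f => [|k IH] f cov /=.
  move=> u /cov[V [g [oV Vu Cg fg]]].
  have fgu : \near u, f u = g u.
    by near=> v; apply: fg; near: v; exact: open_nbhs_nbhs.
  rewrite /prop_for /continuous_at (nbhs_singleton fgu); apply: cvg_trans (Cg u Vu).
  apply: (@near_eq_cvg _ _ (nbhs u) (nbhs_filter u)).
  by apply: filterS fgu => v /esym.
split=> [u /cov[V [g [oV Vu [dg _] fg]]]|w].
  apply: near_eq_differentiable (dg u Vu).
  by near=> v; apply/esym/fg; near: v; exact: open_nbhs_nbhs.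
apply: IH => u /cov[V [g [oV Vu [_ Dg] fg]]].
exists V, ('D_w g); split=> //; [exact: Dg|move=> v Vv; apply: near_eq_derive].
by near=> v'; apply: fg; near: v'; exact: open_nbhs_nbhs.
Unshelve. all: by end_near. Qed.

Lemma Ck_on_eq k O f g : open O -> (forall u, O u -> f u = g u) ->
  Ck_on k O g -> Ck_on k O f.
Proof. by move=> oO fg Cg; apply: Ck_on_local => u Ou; exists O, g. Qed.

Lemma Ck_on_cst k O (a : R) : Ck_on k O (fun=> a).
Proof.
elim: k a => [|k IH] a /=; first by move=> u _; exact: cst_continuous.
split=> [u _|w]; first exact: differentiable_cst.
rewrite (_ : 'D_w _ = (fun=> 0)) //.
by apply/funext => u; exact: derive_cst.
Qed.

Lemma Ck_onD k O f g : open O -> Ck_on k O f -> Ck_on k O g ->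
  Ck_on k O (fun u => f u + g u).
Proof.
move=> oO; elim: k f g => [|k IH] f g /=.
  by move=> cf cg u Ou; exact: (continuousD (cf u Ou) (cg u Ou)).
move=> [df Df] [dg Dg]; split=> [u Ou|w].
  exact: differentiableD (df u Ou) (dg u Ou).
apply: Ck_on_eq (IH _ _ (Df w) (Dg w)) => // u Ou.
by rewrite -deriveD//; apply: diff_derivable; [exact: df|exact: dg].
Qed.

Lemma Ck_onM k O f g : open O -> Ck_on k O f -> Ck_on k O g ->
  Ck_on k O (fun u => f u * g u).
Proof.
move=> oO; elim: k f g => [|k IH] f g.
  by move=> cf cg u Ou; exact: (continuousM (cf u Ou) (cg u Ou)).
move=> Cf Cg; have Cf' := Ck_onW Cf; have Cg' := Ck_onW Cg.
case: Cf Cg => df Df [dg Dg]; split=> [u Ou|w].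
  exact: differentiableM (df u Ou) (dg u Ou).
apply: Ck_on_eq (Ck_onD oO (IH _ _ Cf' (Dg w)) (IH _ _ Cg' (Df w))) => // u Ou.
by rewrite deriveM//; apply: diff_derivable; [exact: df|exact: dg].
Qed.

Lemma Ck_on_sum k O (I : Type) (r : seq I) (F : I -> 'rV[R]_n -> R) :
  open O -> (forall j, Ck_on k O (F j)) ->
  Ck_on k O (fun u => \sum_(j <- r) F j u).
Proof.
move=> oO CF; elim: r => [|j r IH].
  by rewrite (_ : (fun _ => _) = fun=> 0); [exact: Ck_on_cst|
     apply/funext => u; rewrite big_nil].
rewrite (_ : (fun _ => _) = fun u => F j u + \sum_(j <- r) F j u).
  exact: Ck_onD.
by apply/funext => u; rewrite big_cons.
Qed.

End Ck.

(** * The chain rule in coordinates *)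

Section chain.
Context {R : realType} {m n : nat}.
Implicit Types (F : 'rV[R]_m -> R) (phi : 'rV[R]_n -> 'rV[R]_m).

Lemma differentiable_rV phi u :
  (forall j, differentiable (fun v => phi v 0 j) u) -> differentiable phi u.
Proof.
move=> dphi; rewrite (_ : phi =
    \sum_j (fun v => phi v 0 j *: (delta_mx 0 j : 'rV[R]_m))).
  by apply: differentiable_sum => j; exact: differentiableZl.
by apply/funext => v; rewrite fct_sumE {1}[phi v]row_sum_delta.
Qed.

Lemma continuous_rV phi u :
  (forall j, {for u, continuous (fun v => phi v 0 j)}) ->
  {for u, continuous phi}.
Proof.
move=> cphi; rewrite (_ : phi =
    fun v => \sum_j (phi v 0 j *: (delta_mx 0 j : 'rV[R]_m))); last first.
  by apply/funext => v; exact: row_sum_delta.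
apply: (@cvg_big _ _ _ _ _ _ _ (nbhs u) _ _ _ (nbhs_filter u)) => [|j _].
  exact: add_continuous.
by apply: (@cvgZr_tmp _ _ _ (nbhs u) (nbhs_filter u)); exact: cphi.
Qed.

Lemma derive_comp F phi u w : differentiable F (phi u) ->
  (forall j, differentiable (fun v => phi v 0 j) u) ->
  'D_w (F \o phi) u =
  'D_(\row_j 'D_w (fun v => phi v 0 j) u) F (phi u).
Proof.
move=> dF dphi; have dp := differentiable_rV dphi.
rewrite (deriveE _ (differentiable_comp dp dF)) (diff_comp dp dF) (deriveE _ dF).
rewrite /=; congr ('d F _ _).
apply/rowP => j; rewrite mxE (deriveE _ (dphi j)).
have dc : differentiable (fun v : 'rV[R]_m => v 0 j) (phi u).
  exact: differentiable_coord.
by rewrite [in RHS](diff_comp dp dc) /= diff_coord.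
Qed.

(** By the chain rule, a derivative of [F \o phi] is a sum of products of a derivative of a
    coordinate of [phi] with a partial derivative of [F] composed with [phi]; the induction
    hypothesis handles the latter at one order less. *)
Lemma Ck_on_comp k O (V : set 'rV[R]_m) F phi :
  open O -> (forall u, O u -> V (phi u)) -> Ck_on k V F ->
  (forall j, Ck_on k O (fun v => phi v 0 j)) -> Ck_on k O (F \o phi).
Proof.
move=> oO OV; elim: k F => [|k IH] F.
  move=> cF cphi u Ou; apply: continuous_comp; last exact/cF/OV.
  by apply: continuous_rV => j; exact: cphi.
move=> [dF DF] Cphi; have dphi u j : O u -> differentiable (fun v => phi v 0 j) u.
  by move=> Ou; case: (Cphi j) => /(_ u Ou).
split=> [u Ou|w].
  apply: differentiable_comp; last exact/dF/OV.
  by apply: differentiable_rV => j; exact: dphi.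
apply: (@Ck_on_eq _ _ _ _ _ (fun u => \sum_j 'D_w (fun v => phi v 0 j) u
    * ('D_(delta_mx 0 j) F \o phi) u)) => //.
  move=> u Ou; rewrite derive_comp => [|//|j]; [|exact/dF/OV|exact: dphi].
  have dFu := dF _ (OV _ Ou); rewrite (deriveE _ dFu).
  rewrite {1}[\row_j _]row_sum_delta linear_sum; apply: eq_bigr => j _.
  by rewrite linearZ /= mxE -(deriveE _ dFu).
apply: Ck_on_sum => // j; apply: Ck_onM => //.
  by case: (Cphi j) => _; exact.
by apply: IH; [exact: DF|move=> l; exact/Ck_onW/Cphi].
Qed.

End chain.

(* The span of the functions [t^-d exp(-1/t)], extended by 0 to [t <= 0], is
   closed under differentiation. *)
Definition flat (R : realType) (d : nat) (t : R) : R :=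
  if 0 < t then t^-1 ^+ d * expR (- t^-1) else 0.

(** * Smooth functions flat at zero *)

Section flat.
Context {R : realType}.
Implicit Types (d : nat) (t : R).

Lemma flat_ge0 d t : 0 <= flat d t.
Proof.
rewrite /flat; case: ifP => // t0.
by rewrite mulr_ge0 ?expR_ge0// exprn_ge0// invr_ge0 ltW.
Qed.

Lemma flat_le_sqr d t : `|flat d t| <= d.+2`!%:R * t ^+ 2.
Proof.
rewrite ger0_norm ?flat_ge0// /flat; case: ifP => [t0|_]; last first.
  by rewrite mulr_ge0// sqr_ge0.
have s0 : 0 <= t^-1 by rewrite invr_ge0 ltW.
rewrite expRN ler_pdivrMr ?expR_gt0//.
have -> : t^-1 ^+ d = t ^+ 2 * t^-1 ^+ d.+2.
  by rewrite -[d.+2]addn2 exprD mulrCA -exprMn divff ?gt_eqF// expr1n mulr1.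
rewrite [_%:R * _]mulrC -[leRHS]mulrA ler_wpM2l ?sqr_ge0//.
rewrite -ler_pdivrMl ?ltr0n ?fact_gt0// mulrC.
by apply: le_trans (expR_ge1Dxn d.+1 s0); rewrite lerDr.
Qed.

Lemma is_derive_flat d t :
  is_derive t 1 (flat d) (flat d.+2 t - d%:R * flat d.+1 t).
Proof.
have [t0|t0|->] := ltgtP t 0.
- apply: (@near_eq_is_derive _ _ _ (fun=> 0)).
    near=> s; rewrite /flat ifF//; apply/negbTE; rewrite -leNgt ltW//.
    by near: s; exact: lt_nbhsl.
  rewrite /flat !ifF; [|by apply/negbTE; rewrite -leNgt ltW..].
  by rewrite mulr0 subr0; exact: is_derive_cst.
- have tn0 : t != 0 by rewrite gt_eqF.
  apply: (@near_eq_is_derive _ _ _ (((@GRing.inv R) ^+ d) *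
      (expR \o (- (@GRing.inv R))))).
    near=> s; rewrite /flat ifT; last by near: s; exact: lt_nbhsr.
    by rewrite !fctE.
  have dV : is_derive t (1 : R) (@GRing.inv R) (- t ^- 2).
    have dt : derivable (id : R -> R) t 1 by exact: derivable_id.
    split; first exact: (derivableV tn0 dt).
    by rewrite (deriveV tn0 dt) derive_id scaler1.
  have dE := is_derive1_comp (is_derive_expR _) (is_deriveN dV).
  have dX := is_deriveX d dV.
  apply: is_derive_eq (is_deriveM dX dE) _.
  rewrite /flat t0 !fctE /=.
  have -> : t ^- 2 = t^-1 ^+ 2 by rewrite exprVn.
  (* The power rule lowers the exponent [d] by one, so [d = 0] is treated apart. *)
  case: d dX => [|d] dX; rewrite /GRing.scale /= ?exprS; ring.
- have f0 : flat d 0 = 0 :> R by rewrite /flat ltxx.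
  have H : h^-1 *: ((flat d \o shift (0 : R)) (h *: (1 : R)) - flat d 0)
      @[h --> (0 : R)^'] --> (0 : R).
    apply/cvgr0Pnorm_le => e e0; near=> h.
    have hn0 : h != 0 by near: h; exact: nbhs_dnbhs_neq.
    rewrite /= addr0 f0 subr0 /GRing.scale /= mulr1 normrM normfV.
    rewrite ler_pdivrMl ?normr_gt0//; apply: (le_trans (flat_le_sqr _ _)).
    rewrite -real_normK ?num_real// expr2 mulrCA ler_pM2l ?normr_gt0//.
    rewrite -ler_pdivlMl ?ltr0n ?fact_gt0// mulrC ltW//.
    near: h; apply: dnbhs0_lt.
    by rewrite divr_gt0// ltr0n fact_gt0.
  rewrite {2 3}/flat ltxx mulr0 subr0; split; first by apply/cvg_ex; exists 0.
  exact: cvg_lim H.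
Unshelve. all: by end_near. Qed.

(** Deriving [flat d] only produces other members of the family, so the induction on [k] runs for
    all [d] at once. *)
Lemma Ck_on_flat n k d (O : set 'rV[R]_n) (rho : 'rV[R]_n -> R) :
  open O -> Cinf_on O rho -> Ck_on k O (fun u => flat d (rho u)).
Proof.
have df e t : differentiable (flat e : R -> R) t.
  by apply/derivable1_diffP; case: (is_derive_flat e t).
move=> oO Crho; elim: k d => [|k IH] d.
  move=> u Ou; apply: continuous_comp; first exact: (Crho 0%N).
  exact/differentiable_continuous/df.
have drho u : O u -> differentiable rho u by case: (Crho 1%N) => + _; exact.
split=> [u Ou|w]; first exact: differentiable_comp (drho u Ou) (df _ _).
apply: (@Ck_on_eq _ _ _ _ _ (fun u =>
    (flat d.+2 (rho u) + - d%:R * flat d.+1 (rho u)) * 'D_w rho u)) => //.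
  move=> u Ou.
  rewrite (deriveE _ (differentiable_comp (drho u Ou) (df d _))).
  rewrite (diff_comp (drho u Ou) (df d _)) /= (deriveE _ (drho u Ou)).
  have [/deriv1E -> fE] := is_derive_flat d (rho u).
  by rewrite derive1E fE /GRing.scale /= mulrC mulNr.
apply: Ck_onM => //; last by case: (Crho k.+1) => _; exact.
by apply: Ck_onD => //; apply: Ck_onM => //; exact: Ck_on_cst.
Qed.

End flat.

(** * Smooth functions and tangent vectors *)

Section manifold.
Context {R : realType} {M : manifold R}.
Implicit Types (c : chart R M (cdim M)) (U V : set M) (f g : M -> R).

Lemma atlas_chart c : atlas c -> is_chart c.
Proof. by case: (manifoldP M) => _ _ + _ _; exact. Qed.

Lemma chart_at (x : M) : exists2 c, @atlas R M c & cdom c x.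
Proof. by case: (manifoldP M) => _ _ _ + _; exact. Qed.

Lemma chartK c x : atlas c -> cdom c x -> cinv c (cmap c x) = x.
Proof. by move=> /atlas_chart[_ _ + _ _]; exact. Qed.

Lemma open_chart_image c U : atlas c -> open U ->
  open (cmap c @` (cdom c `&` U)).
Proof.
move=> /atlas_chart[od oi cK _ ci] oU.
move: ci; rewrite (continuous_open_subspace _ oi) => ci.
(* Inside the open image of the chart, the image of [U] is its preimage under [cinv c], which is
   continuous there. *)
rewrite (_ : _ @` _ = (cmap c @` cdom c) `&` (cinv c @^-1` U)).
  by have [/(_ ci) + _] := continuous_inP (cinv c) oi; exact.
apply/seteqP; split=> [_ [x [cx Ux] <-]|_ [[x cx <-]]] /=.
  by rewrite cK//; split=> //; exists x.
by rewrite cK// => Ux; exists x.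
Qed.

Lemma chart_nbhs c x U : atlas c -> cdom c x -> open U -> U x ->
  nbhs (cmap c x) (cmap c @` (cdom c `&` U)).
Proof.
by move=> ac cx oU Ux; apply: open_nbhs_nbhs; split;
  [exact: open_chart_image|exists x].
Qed.

Lemma smooth_onS U V f : V `<=` U -> smooth_on U f -> smooth_on V f.
Proof.
move=> VU sf c ac k; apply: Ck_onS (sf c ac k).
by move=> _ [x [cx Vx] <-]; exists x => //; split=> //; exact: VU.
Qed.

Lemma smooth_on_local U f :
  (forall x, U x -> exists V g,
     [/\ open V, V x, smooth_on V g & forall y, V y -> f y = g y]) ->
  smooth_on U f.
Proof.
move=> cov c ac k; apply: Ck_on_local => _ [x [cx /cov[V [g [oV Vx sg fg]]]] <-].
exists (cmap c @` (cdom c `&` V)), (g \o cinv c).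
split; [exact: open_chart_image|by exists x|exact: sg|].
by move=> _ [y [cy Vy] <-] /=; rewrite chartK// fg.
Qed.

Lemma smooth_on_cst U (a : R) : smooth_on U (fun=> a).
Proof. by move=> c _ k; exact: Ck_on_cst. Qed.

Lemma smooth_onD U f g : open U -> smooth_on U f -> smooth_on U g ->
  smooth_on U (fun x => f x + g x).
Proof.
move=> oU sf sg c ac k.
by apply: Ck_onD (sf c ac k) (sg c ac k); exact: open_chart_image.
Qed.

Lemma smooth_onM U f g : open U -> smooth_on U f -> smooth_on U g ->
  smooth_on U (fun x => f x * g x).
Proof.
move=> oU sf sg c ac k.
by apply: Ck_onM (sf c ac k) (sg c ac k); exact: open_chart_image.
Qed.

Lemma smooth_on_sum U (I : Type) (r : seq I) (F : I -> M -> R) :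
  open U -> (forall j, smooth_on U (F j)) ->
  smooth_on U (fun x => \sum_(j <- r) F j x).
Proof.
move=> oU sF c ac k.
have := @Ck_on_sum _ _ k _ _ r (fun j => F j \o cinv c)
  (open_chart_image ac oU) (fun j => sF j c ac k).
exact.
Qed.

Lemma smooth_on_flat U d f : open U -> smooth_on U f ->
  smooth_on U (fun x => flat d (f x)).
Proof.
move=> oU sf c ac k.
by apply: (Ck_on_flat k d _ (sf c ac)); exact: open_chart_image.
Qed.

Lemma smooth_on_chart c j : atlas c ->
  smooth_on (cdom c) (fun x => cmap c x 0 j).
Proof.
case: (manifoldP M) => _ _ _ _ compat ac d ad; exact: (compat d c ad ac j).
Qed.

Lemma smooth_smooth_near f x : smooth f -> smooth_near x f.
Proof. by move=> sf; exists setT; split=> //; exact: openT. Qed.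

Lemma smooth_nearD x f g : smooth_near x f -> smooth_near x g ->
  smooth_near x (fun y => f y + g y).
Proof.
move=> [U [oU Ux sf]] [V [oV Vx sg]]; exists (U `&` V).
split=> //; first exact: openI.
by apply: smooth_onD; [exact: openI| |];
  [apply: smooth_onS sf|apply: smooth_onS sg] => y [].
Qed.

Lemma smooth_near_diff c f x : atlas c -> cdom c x -> smooth_near x f ->
  differentiable (f \o cinv c) (cmap c x).
Proof.
move=> ac cx [U [oU Ux /(_ c ac 1%N) [df _]]].
by apply: df; exists x.
Qed.

Definition chart_vec c (x : M) (u : 'rV[R]_(cdim M)) : tvec M :=
  fun f => if `[< smooth_near x f >]
           then 'D_u (f \o cinv c) (cmap c x) else 0.

Lemma chart_vec_tangent c x u : atlas c -> cdom c x ->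
  tangent x (chart_vec c x u).
Proof. by move=> ac cx; exists c, u. Qed.

Lemma chart_vecE c x u f : smooth_near x f ->
  chart_vec c x u f = 'D_u (f \o cinv c) (cmap c x).
Proof. by move=> sf; rewrite /chart_vec asboolT. Qed.

Lemma chart_vecP c x k u w : atlas c -> cdom c x ->
  chart_vec c x (k *: u + w) = k *: chart_vec c x u + chart_vec c x w.
Proof.
move=> ac cx; apply/funext => f; rewrite /chart_vec !fctE.
case: asboolP => [sf|_]; last by rewrite scaler0 addr0.
by rewrite !deriveE ?linearP//; exact: smooth_near_diff.
Qed.

End manifold.

(** * Smooth maps and their derivatives in charts *)

Section smooth_map.
Context {R : realType} {M N : manifold R} (F : M -> N).
Hypothesis sF : smooth_map F.

Lemma smooth_on_comp (U : set N) f : open U -> smooth_on U f ->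
  smooth_on (F @^-1` U) (f \o F).
Proof.
case: sF => cF sFd oU sf c ac k; apply: Ck_on_local => _ [x [cx UFx] <-].
have [d ad dFx] := chart_at (F x).
have od : open (cdom d) by case: (atlas_chart ad).
have oV : open (F @^-1` (U `&` cdom d)).
  by move/continuousP: cF; apply; exact: openI.
have oO := open_chart_image ac oV.
exists (cmap c @` (cdom c `&` (F @^-1` (U `&` cdom d)))).
exists ((f \o cinv d) \o (fun v => cmap d (F (cinv c v)))); split=> //.
- by exists x.
- apply: (Ck_on_comp oO _ (sf d ad k)) => [_ [y [cy [Uy dy]] <-]|j].
    by exists (F y) => //; rewrite chartK.
  apply: Ck_onS (sFd d ad j c ac k).
  by move=> _ [y [cy [Uy dy]] <-]; exists y.
by move=> _ [y [cy [Uy dy]] <-] /=; rewrite chartK// chartK.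
Qed.

Lemma smooth_near_comp x f : smooth_near (F x) f -> smooth_near x (f \o F).
Proof.
move=> [U [oU Ux sf]]; exists (F @^-1` U); split=> //.
  by case: sF => /continuousP + _; exact.
exact: smooth_on_comp.
Qed.

(** In charts the tangent map acts by the Jacobian matrix. For the identity map this is the change
    of charts. *)
Lemma tmap_chart_vec c d x u : atlas c -> cdom c x -> atlas d ->
  cdom d (F x) ->
  tmap F x (chart_vec c x u) = chart_vec d (F x)
    (\row_j 'D_u (fun v => cmap d (F (cinv c v)) 0 j) (cmap c x)).
Proof.
move=> ac cx ad dFx; apply/funext => f; rewrite /tmap /chart_vec.
case: (asboolP (smooth_near (F x) f)) => // sf.
rewrite asboolT; last exact: smooth_near_comp.
have [cF sFd] := sF.
have od : open (cdom d) by case: (atlas_chart ad).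
have oV : open (F @^-1` cdom d) by move/continuousP: cF; exact.
have EFx : F x = F (cinv c (cmap c x)) by rewrite chartK.
transitivity ('D_u ((f \o cinv d) \o (fun v => cmap d (F (cinv c v))))
    (cmap c x)).
  apply: near_eq_derive; apply: filterS (chart_nbhs ac cx oV dFx).
  by move=> _ [y [cy dy] <-] /=; rewrite chartK// chartK.
rewrite derive_comp; first by rewrite -EFx.
- by rewrite -EFx; exact: smooth_near_diff.
- by move=> j; case: (sFd d ad j c ac 1%N) => + _; apply; exists x.
Qed.

End smooth_map.

(** * Tangent vectors as derivations *)

Section tangent.
Context {R : realType} {M : manifold R}.
Implicit Types (c : chart R M (cdim M)) (U V : set M) (f g : M -> R).
Implicit Types (x : M) (v w : tvec M).

Lemma smooth_map_id : @smooth_map R M M id.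
Proof.
split; first by move=> x; exact: cvg_id.
by move=> d ad j; exact: smooth_on_chart.
Qed.

(** The chart in the definition of [tangent] is existentially quantified; the derivative of the
    identity, written in two charts, transfers the vector to the chart [c]. *)
Lemma tangentE c x v : atlas c -> cdom c x -> tangent x v ->
  exists u, v = chart_vec c x u.
Proof.
move=> ac cx [d [u [ad dx ->]]].
rewrite -[X in exists _, X = _]/(chart_vec d x u).
have <- : tmap id x (chart_vec d x u) = chart_vec d x u.
  by apply/funext => f; rewrite /tmap /chart_vec; case: asboolP.
by eexists; exact: (tmap_chart_vec smooth_map_id u ad dx ac cx).
Qed.

Lemma tangentP x k v w : tangent x v -> tangent x w ->
  tangent x (k *: v + w).
Proof.
have [c ac cx] := chart_at x.
move=> /(tangentE ac cx)[u ->] /(tangentE ac cx)[u' ->].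
by rewrite -chart_vecP//; exact: chart_vec_tangent.
Qed.

Lemma tangent0 x : tangent x (0 : tvec M).
Proof.
have [c ac cx] := chart_at x.
suff -> : (0 : tvec M) = chart_vec c x 0 by exact: chart_vec_tangent.
by apply/funext => f; rewrite /chart_vec derive0 if_same.
Qed.

Lemma tangentD x v w : tangent x v -> tangent x w -> tangent x (v + w).
Proof. by move=> tv tw; rewrite -[v]scale1r; exact: tangentP. Qed.

Lemma tangentZ x k v : tangent x v -> tangent x (k *: v).
Proof.
by move=> tv; rewrite -[_ *: _]addr0; apply: tangentP => //; exact: tangent0.
Qed.

Lemma tangentB x v w : tangent x v -> tangent x w -> tangent x (v - w).
Proof. by move=> tv tw; rewrite addrC -scaleN1r; exact: tangentP. Qed.

Lemma tangent_sum x (I : Type) (r : seq I) (e : I -> tvec M) :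
  (forall j, tangent x (e j)) -> tangent x (\sum_(j <- r) e j).
Proof.
move=> te; elim/big_ind : _ => //; [exact: tangent0|exact: tangentD].
Qed.

Lemma tangent_cst x v (a : R) : tangent x v -> v (fun=> a) = 0.
Proof.
move=> [c [u [ac cx ->]]]; rewrite asboolT; first exact: derive_cst.
exact/smooth_smooth_near/smooth_on_cst.
Qed.

Lemma tangentfD x v f g : tangent x v -> smooth_near x f ->
  smooth_near x g -> v (fun y => f y + g y) = v f + v g.
Proof.
move=> [c [u [ac cx ->]]] sf sg; rewrite !asboolT//; last exact: smooth_nearD.
by rewrite -deriveD//; apply: diff_derivable; exact: smooth_near_diff.
Qed.

Lemma smooth_nearM x f g : smooth_near x f -> smooth_near x g ->
  smooth_near x (fun y => f y * g y).
Proof.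
move=> [U [oU Ux sf]] [V [oV Vx sg]]; exists (U `&` V).
split=> //; first exact: openI.
by apply: smooth_onM; [exact: openI| |];
  [apply: smooth_onS sf|apply: smooth_onS sg] => y [].
Qed.

Lemma tangentfM x v f g : tangent x v -> smooth_near x f ->
  smooth_near x g -> v (fun y => f y * g y) = f x * v g + g x * v f.
Proof.
move=> [c [u [ac cx ->]]] sf sg; rewrite !asboolT//; last exact: smooth_nearM.
have df : derivable (f \o cinv c) (cmap c x) u.
  exact/diff_derivable/smooth_near_diff.
have dg : derivable (g \o cinv c) (cmap c x) u.
  exact/diff_derivable/smooth_near_diff.
transitivity ('D_u ((f \o cinv c) * (g \o cinv c)) (cmap c x)) => //.
by rewrite (deriveM df dg) /= chartK.
Qed.

End tangent.

(** * Bump functions and global coordinates at a point *)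

Section bump.
Context {R : realType} {M : manifold R}.
Implicit Types (c : chart R M (cdim M)) (f g : M -> R).

(** In the chart, [b] is [flat 0] of [r ^+ 2] minus the squared Euclidean distance to [cmap c x]. It
    vanishes off a compact set, closed because [M] is Hausdorff, so [b * g] extends by 0 whatever
    the values of [g] outside the chart. *)
Lemma exists_bump c x : atlas c -> cdom c x ->
  exists b : M -> R, b x != 0 /\
    forall g, smooth_on (cdom c) g -> smooth (fun y => b y * g y).
Proof.
move=> ac cx; have [od oi cK cc ci] := atlas_chart ac.
set u0 := cmap c x.
have /nbhs_ballP[r0 /= r00 br0] : nbhs u0 (cmap c @` cdom c).
  by apply: open_nbhs_nbhs; split=> //; exists x.
(* Halving the radius keeps the closed cube [C] of half-side [r] inside the open ball of radius [r0]
   for the sup norm. *)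
pose r := r0 / 2; have r_gt0 : 0 < r by rewrite divr_gt0.
pose C := [set u : 'rV[R]_(cdim M) |
  forall j, `[u0 0 j - r, u0 0 j + r]%classic (u ord0 j)].
have CO : C `<=` cmap c @` cdom c.
  move=> u Cu; apply: br0; split=> // i j; rewrite !ord1.
  have := Cu j; rewrite /= in_itv /= /ball /= -ler_distlC.
  move=> /le_lt_trans; apply; rewrite /r ltr_pdivrMr//.
  by rewrite ltr_pMr// ltr1n.
have clK : closed (cinv c @` C).
  apply: compact_closed; first by case: (manifoldP M).
  apply: continuous_compact.
    exact: continuous_subspaceW ci.
  by apply: (@rV_compact R _ (fun j => `[u0 0 j - r, u0 0 j + r]%classic)) => j;
    exact: segment_compact.
pose rho (y : M) := r ^+ 2 + \sum_j (- ((cmap c y 0 j + - u0 0 j) *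
  (cmap c y 0 j + - u0 0 j))).
pose b (y : M) := if `[< cdom c y >] then flat 0 (rho y) else 0.
have srho : smooth_on (cdom c) rho.
  apply: smooth_onD => //; first exact: smooth_on_cst.
  apply: smooth_on_sum => // j.
  have sj : smooth_on (cdom c) (fun y => cmap c y 0 j + - u0 0 j).
    apply: smooth_onD => //; [exact: smooth_on_chart|exact: smooth_on_cst].
  rewrite (_ : (fun _ => _) = fun y => -1 * ((cmap c y 0 j + - u0 0 j) *
    (cmap c y 0 j + - u0 0 j))); last by apply/funext => y; rewrite mulN1r.
  by apply: smooth_onM => //; [exact: smooth_on_cst|exact: smooth_onM].
have b0 y : (~` (cinv c @` C)) y -> b y = 0.
  move=> nK; rewrite /b; case: asboolP => // cy.
  rewrite /flat ifF//; apply/negbTE; rewrite -leNgt.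
  (* If [rho y] is positive, the sum of squares is below [r ^+ 2], hence so is each single square,
     and [cmap c y] lies in [C]. *)
  apply: contra_notT nK; rewrite -ltNge => rho_gt0.
  exists (cmap c y); last exact: cK.
  move=> j; rewrite /= in_itv /= -ler_distlC distrC.
  rewrite -(@ler_pXn2r _ 2) ?nnegrE ?normr_ge0 ?(ltW r_gt0)//.
  move: rho_gt0; rewrite /rho sumrN subr_gt0 => /ltW/(le_trans _); apply.
  rewrite real_normK ?num_real// (bigD1 j)//= expr2 lerDl.
  by apply: sumr_ge0 => k _; rewrite -expr2 sqr_ge0.
exists b; split.
  rewrite /b asboolT// /flat /rho big1 ?addr0; last first.
    by move=> j _; rewrite subrr mul0r oppr0.
  by rewrite exprn_gt0// expr0 mul1r gt_eqF// expR_gt0.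
move=> g sg; apply: smooth_on_local => y _.
have [cy|ncy] := pselect (cdom c y).
  exists (cdom c), (fun y => flat 0 (rho y) * g y); split=> //.
    by apply: smooth_onM => //; exact: smooth_on_flat.
  by move=> z cz; rewrite /b asboolT.
exists (~` (cinv c @` C)), (fun=> 0); split=> //.
- exact: closed_openC.
- move=> [u /CO[z cz <-] uy]; apply: ncy; by rewrite -uy cK.
- exact: smooth_on_cst.
by move=> z nz; rewrite b0// mul0r.
Qed.

(** The [e j] are the coordinate vectors, and the [h k] are the centred coordinates cut off by a
    bump. They are smooth on all of [M], as is required of functions to which [induces] or a bracket
    applies. *)
Lemma tangent_basis x : exists (e : 'I_(cdim M) -> tvec M)
    (h : 'I_(cdim M) -> M -> R),
  [/\ forall j, tangent x (e j), forall j, smooth (h j),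
      forall v, tangent x v -> v = \sum_j v (h j) *: e j &
      forall j k, e j (h k) = (j == k)%:R].
Proof.
have [c ac cx] := chart_at x.
have [b [bx sb]] := exists_bump ac cx.
have [od _ cK _ _] := atlas_chart ac.
pose g k (y : M) := cmap c y 0 k + - cmap c x 0 k.
have sg k : smooth_on (cdom c) (g k).
  apply: smooth_onD => //; [exact: smooth_on_chart|exact: smooth_on_cst].
pose h k (y : M) := b y * ((b x)^-1 * g k y).
have sh k : smooth (h k).
  by apply: sb; apply: smooth_onM => //; exact: smooth_on_cst.
have near_g k : smooth_near x (g k) by exists (cdom c).
have near_b : smooth_near x b.
  apply: smooth_smooth_near; rewrite (_ : b = fun y => b y * 1).
    by apply: sb; exact: smooth_on_cst.
  by apply/funext => y; rewrite mulr1.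
have near_cst (a : R) : smooth_near x (fun=> a).
  exact/smooth_smooth_near/smooth_on_cst.
have near_c k : smooth_near x (fun y => cmap c y 0 k).
  by exists (cdom c); split=> //; exact: smooth_on_chart.
have vh u k : chart_vec c x u (h k) = u 0 k.
  have tu := chart_vec_tangent u ac cx.
  (* As [g k] vanishes at [x], the product rule leaves only [b x * (b x)^-1] times the derivative of
     the coordinate. *)
  rewrite (tangentfM tu) => [|//|]; last exact: smooth_nearM.
  rewrite (tangentfM tu)// (tangent_cst _ tu) mulr0 addr0 {2}/g subrr mulr0.
  rewrite mul0r addr0 mulrA divff// mul1r.
  rewrite (tangentfD tu)// (tangent_cst _ tu) addr0 chart_vecE//.
  rewrite (near_eq_derive (g := fun v : 'rV[R]_(cdim M) => v 0 k)); last first.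
    apply: filterS (chart_nbhs ac cx openT I) => _ [y [cy _] <-] /=.
    by rewrite cK.
  by rewrite deriveE ?diff_coord//; exact: differentiable_coord.
exists (fun j => chart_vec c x (delta_mx 0 j)), h; split=> //.
- by move=> j; exact: chart_vec_tangent.
- move=> v /(tangentE ac cx)[u ->].
  rewrite {1}[u]row_sum_delta; under [RHS]eq_bigr do rewrite vh.
  have cZ k u1 : chart_vec c x (k *: u1) = k *: chart_vec c x u1.
    rewrite -[k *: u1]addr0 chart_vecP//.
    have -> : chart_vec c x 0 = 0 :> tvec M.
      by apply/funext => f; rewrite /chart_vec derive0 if_same.
    by rewrite addr0.
  elim/big_rec2 : _ => [|j v1 v2 _ <-].
    by apply/funext => f; rewrite /chart_vec derive0 if_same.
  by rewrite chart_vecP.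
- by move=> j k; rewrite vh mxE eqxx /= eq_sym.
Qed.

End bump.

(** * Covectors and differentials *)

Section cotangent.
Context {R : realType} {M : manifold R}.
Implicit Types (x : M) (v w : tvec M) (a b : cvec M) (f : M -> R).

Lemma cotangent0 x a : cotangent x a -> a 0 = 0.
Proof.
move=> [aP _]; have := aP 1 0 0 (tangent0 x) (tangent0 x).
by rewrite scale1r mul1r addr0 => a00; apply: (addrI (a 0)); rewrite addr0 -a00.
Qed.

Lemma cotangentP x k v w a : cotangent x a -> tangent x v -> tangent x w ->
  a (k *: v + w) = k * a v + a w.
Proof. by case=> aP _; exact: aP. Qed.

Lemma cotangent_sum x (I : Type) (r : seq I) (c : I -> R) (e : I -> tvec M) a :
  cotangent x a -> (forall j, tangent x (e j)) ->
  a (\sum_(j <- r) c j *: e j) = \sum_(j <- r) c j * a (e j).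
Proof.
move=> ca te; elim: r => [|j r IH]; first by rewrite !big_nil (cotangent0 ca).
rewrite !big_cons (cotangentP _ ca) ?IH//.
by apply: tangent_sum => k; exact: tangentZ.
Qed.

Lemma cotangent_lin x k a b : cotangent x a -> cotangent x b ->
  cotangent x (k *: a + b).
Proof.
move=> [aP a0] [bP b0]; split=> [l v w tv tw|v nv].
  rewrite !fctE /= aP// bP// /GRing.scale /=; ring.
by rewrite !fctE /= a0// b0// scaler0 addr0.
Qed.

Lemma cotangent_zero x : cotangent x (0 : cvec M).
Proof. by split=> // l v w _ _; rewrite mulr0 addr0. Qed.

Lemma cotangent_lincomb x (I : Type) (r : seq I) (c : I -> R)
    (e : I -> cvec M) :
  (forall j, cotangent x (e j)) -> cotangent x (\sum_(j <- r) c j *: e j).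
Proof.
move=> ce; elim: r => [|j r IH]; first by rewrite big_nil; exact: cotangent_zero.
by rewrite big_cons; exact: cotangent_lin.
Qed.

Lemma cotangentB x a b : cotangent x a -> cotangent x b -> cotangent x (a - b).
Proof. by move=> ca cb; rewrite addrC -scaleN1r; exact: cotangent_lin. Qed.

Lemma cotangent_eq x a b : cotangent x a -> cotangent x b ->
  (forall v, tangent x v -> a v = b v) -> a = b.
Proof.
move=> [_ a0] [_ b0] ab; apply/funext => v.
by have [/ab//|nv] := pselect (tangent x v); rewrite a0// b0.
Qed.

Lemma differentialE x v f : tangent x v -> differential f x v = v f.
Proof. by move=> tv; rewrite /differential asboolT. Qed.

Lemma differential_cotangent x f : cotangent x (differential f x).
Proof.
split=> [k v w tv tw|v nv]; last by rewrite /differential asboolF.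
by rewrite !differentialE//; exact: tangentP.
Qed.

Lemma tangentf_lincomb x v (I : Type) (r : seq I) (c : I -> R)
    (h : I -> M -> R) : tangent x v -> (forall k, smooth_near x (h k)) ->
  v (fun y => \sum_(k <- r) c k * h k y) = \sum_(k <- r) c k * v (h k).
Proof.
move=> tv sh.
have near_cst (d : R) : smooth_near x (fun=> d).
  exact/smooth_smooth_near/smooth_on_cst.
(* Smoothness of the partial sums is carried along, since additivity of [v] holds only for functions
   smooth near [x]. *)
suff [] : v (fun y => \sum_(k <- r) c k * h k y) = \sum_(k <- r) c k * v (h k)
  /\ smooth_near x (fun y => \sum_(k <- r) c k * h k y) by [].
elim: r => [|k r [IH sr]].
  rewrite (_ : (fun _ => _) = fun=> 0); last first.
    by apply/funext => y; rewrite big_nil.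
  by rewrite big_nil; split=> //; exact: tangent_cst tv.
rewrite (_ : (fun _ => _) = fun y => c k * h k y + \sum_(k <- r) c k * h k y);
  last by apply/funext => y; rewrite big_cons.
have sk : smooth_near x (fun y => c k * h k y) by exact: smooth_nearM.
rewrite big_cons; split; last exact: smooth_nearD.
by rewrite (tangentfD tv)// IH (tangentfM tv)// (tangent_cst _ tv) mulr0 addr0.
Qed.

End cotangent.

(** * The tangent map on vectors *)

Section tmap.
Context {R : realType} {M N : manifold R} (F : M -> N).
Hypothesis sF : smooth_map F.

Lemma tmapE x v f : smooth f -> tmap F x v f = v (f \o F).
Proof. by move=> sf; rewrite /tmap asboolT//; exact: smooth_smooth_near. Qed.

Lemma tmap_lincomb x (I : Type) (r : seq I) (c : I -> R) (e : I -> tvec M) :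
  tmap F x (\sum_(j <- r) c j *: e j) = \sum_(j <- r) c j *: tmap F x (e j).
Proof.
apply/funext => f; rewrite /tmap !fct_sumE.
case: asboolP => [sf|nf]; rewrite ?fct_sumE /=.
  by apply: eq_bigr => j _; rewrite !fctE asboolT.
by rewrite big1// => j _; rewrite !fctE asboolF// scaler0.
Qed.

Lemma tmap_tangent x v : tangent x v -> tangent (F x) (tmap F x v).
Proof.
have [c ac cx] := chart_at x; have [d ad dx] := chart_at (F x).
move=> /(tangentE ac cx)[u ->].
by rewrite (tmap_chart_vec sF _ ac cx ad dx); exact: chart_vec_tangent.
Qed.

End tmap.

(** The functions dual to a basis of the tangent space can be taken globally smooth, so global
    functions already separate tangent vectors. *)
Lemma tangent_eq (R : realType) (M : manifold R) (x : M) (v w : tvec M) :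
  tangent x v -> tangent x w -> (forall f, smooth f -> v f = w f) -> v = w.
Proof.
move=> tv tw vw; have [e [h [_ sh he _]]] := tangent_basis x.
by rewrite (he _ tv) (he _ tw); apply: eq_bigr => j _; rewrite vw.
Qed.

(** The rows of [A] lie in the kernel of [B^T], whose dimension [m - r = n] is the rank of [A]; the
    two spaces coincide. *)
Lemma orthogonal_row_space (F : fieldType) (m n r : nat) (A : 'M[F]_(n, m))
    (B : 'M[F]_(r, m)) (v : 'rV[F]_m) :
  m = (n + r)%N -> row_free A -> row_free B -> A *m B^T = 0 ->
  v *m B^T = 0 -> (v <= A)%MS.
Proof.
move=> mnr fA fB AB vB.
have sAB : (A <= kermx B^T)%MS by apply/sub_kermxP.
have : (kermx B^T <= A)%MS.
  rewrite -(mxrank_leqif_sup sAB) mxrank_ker mxrank_tr (eqP fA) (eqP fB).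
  by rewrite mnr addnK.
by apply: submx_trans; apply/sub_kermxP.
Qed.

Lemma lspan_rangeP (R : realType) (V : lmodType R) m (e : 'I_m -> V) v :
  lspan (range e) v <-> exists c : 'I_m -> R, v = \sum_k c k *: e k.
Proof.
split=> [[r [c [f [ef ->]]]]|[c ->]]; last first.
  by exists m, c, e; split=> // k; exists k.
have /choice[k fk] : forall j, exists l, e l = f j.
  by move=> j; case: (ef j) => l; exists l.
(* A combination in [lspan] may use the same vector several times, so coefficients with the same
   index are added up. *)
exists (fun l => \sum_(j | k j == l) c j).
rewrite (partition_big k predT)//=; apply: eq_bigr => l _.
rewrite scaler_suml; apply: eq_bigr => j /eqP <-.
by rewrite fk.
Qed.

(** * The level set of the momentum map *)

Section level_set.
Context {R : realType} {M N : manifold R} {G : lieGroup R}.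
Context {P : M -> cvec G} {i : N -> M}.
Hypothesis P_coalg : forall x, lie_coalg (P x).
Hypothesis P_smooth : forall xi, lie_alg xi -> smooth (fun x => P x xi).
Hypothesis P_regular : zero_regular_value P.
Hypothesis N_level : zero_level P i.

Let si : smooth_map i. Proof. by case: N_level => -[]. Qed.

Lemma level_eq0 z : P (i z) = 0.
Proof.
case: N_level => _ iE _; have : range i (i z) by exists z.
by rewrite iE.
Qed.

Lemma tangent_level_eq0 z w xi : lie_alg xi -> tangent z w ->
  tmap i z w (fun y => P y xi) = 0.
Proof.
move=> gxi tw; rewrite tmapE; last exact: P_smooth.
rewrite (_ : _ \o _ = fun=> 0); first exact: tangent_cst tw.
by apply/funext => z' /=; rewrite level_eq0.
Qed.

Lemma momentum_lincomb (I : Type) (r : seq I) (c : I -> R) (xi : I -> tvec G) :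
  (forall t, lie_alg (xi t)) ->
  (fun y => P y (\sum_(t <- r) c t *: xi t)) =
  fun y => \sum_(t <- r) c t * P y (xi t).
Proof.
by move=> gxi; apply/funext => y; exact: (cotangent_sum _ _ (P_coalg y) gxi).
Qed.

(** [A] is the matrix of [T_z i] and [B] that of [T_x P] at [x = i z], in bases of the three tangent
    spaces. The three matrix facts say that [i] is an immersion, that 0 is a regular value, and that
    [P \o i] vanishes. *)
Lemma level_frames z : exists (e : 'I_(cdim M) -> tvec M)
    (h : 'I_(cdim M) -> M -> R) (f : 'I_(cdim N) -> tvec N)
    (xi : 'I_(cdim G) -> tvec G),
  [/\ forall j, tangent (i z) (e j),
      forall v, tangent (i z) v -> v = \sum_j v (h j) *: e j,
      forall s, tangent z (f s) &
      forall t, lie_alg (xi t)] /\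
  let A := \matrix_(s, j) tmap i z (f s) (h j) in
  let B := \matrix_(t, j) e j (fun y => P y (xi t)) in
  [/\ row_free A, row_free B & A *m B^T = 0].
Proof.
have [e [h [te sh he eh]]] := tangent_basis (i z).
have [f [k [tf sk kf fk]]] := tangent_basis z.
have [xi [H [txi sH Hxi xiH]]] := tangent_basis (lone G).
exists e, h, f, xi; split=> // A B.
have evalB v t : tangent (i z) v ->
    v (fun y => P y (xi t)) = \sum_j v (h j) * B t j.
  move=> tv; rewrite {1}(he v tv) fct_sumE; apply: eq_bigr => j _.
  by rewrite !fctE !mxE.
split.
(* [u *m A] holds the coordinates of [tmap i z w]; once [w = 0], the dual functions [k] recover the
   entries of [u]. *)
- apply/inj_row_free => u uA.
  pose w := \sum_s u 0 s *: f s.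
  have tw : tangent z w by apply: tangent_sum => s; exact: tangentZ.
  have w0 : w = 0.
    have [[_ _ inj_i _] _ _] := N_level.
    apply: (inj_i z) => //; first exact: tangent0.
    have -> : tmap i z 0 = 0 by apply/funext => g; rewrite /tmap if_same.
    rewrite (he _ (tmap_tangent si tw)) big1// => j _.
    have := congr1 (fun X : 'rV_(cdim M) => X 0 j) uA.
    rewrite mxE [RHS]mxE => uAj.
    rewrite tmap_lincomb fct_sumE (_ : \sum_(_ < _) _ = 0) ?scale0r//.
    by rewrite -[RHS]uAj; apply: eq_bigr => s _; rewrite mxE !fctE.
  apply/rowP => s; rewrite mxE.
  transitivity (w (k s)); last by rewrite w0.
  rewrite /w fct_sumE (bigD1 s)//= !fctE fk eqxx /GRing.scale /= mulr1.
  rewrite big1 ?addr0// => s' /negbTE s's.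
  by rewrite fk s's scaler0.
(* Regularity gives a preimage [v t] under the derivative of [P] of each covector [dH_t], dual to
   the basis [xi]; the coordinates of the [v t] form a right inverse of [B]. *)
- have /choice[v vP] : forall t, exists v, tangent (i z) v /\
      forall x, lie_alg x -> v (fun y => P y x) = differential (H t) (lone G) x.
    move=> t; have cH := differential_cotangent (lone G) (H t).
    by have [v tv vE] := P_regular (level_eq0 z) cH; exists v.
  apply/row_freeP; exists (\matrix_(j, t) v t (h j)).
  apply/matrixP => s t; rewrite !mxE.
  have [tv vE] := vP t.
  transitivity (v t (fun y => P y (xi s))).
    by rewrite evalB//; apply: eq_bigr => j _; rewrite !mxE mulrC.
  by rewrite (vE _ (txi s)) differentialE// xiH.
apply/matrixP => s t; rewrite !mxE.
rewrite -[RHS](tangent_level_eq0 (txi t) (tf s)) evalB; last exact: tmap_tangent.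
by apply: eq_bigr => j _; rewrite !mxE.
Qed.

Lemma level_dim (z : N) : cdim M = (cdim N + cdim G)%N.
Proof. by case: N_level => _ _ /(_ z). Qed.

(** The coordinates of [v] are orthogonal to the rows of [B], hence in the row space of [A] because
    [dim M = dim N + dim G]. *)
Lemma tangent_level z v : tangent (i z) v ->
  (forall xi, lie_alg xi -> v (fun y => P y xi) = 0) ->
  exists2 w, tangent z w & tmap i z w = v.
Proof.
move=> tv vP.
have [e [h [f [xi [[te he tf gxi] [fA fB AB]]]]]] := level_frames z.
have /submxP[u uE] : ((\row_j v (h j)) <= \matrix_(s, j) tmap i z (f s) (h j))%MS.
  apply: orthogonal_row_space (level_dim z) fA fB AB _.
  apply/rowP => t; rewrite !mxE -[RHS](vP _ (gxi t)) {2}(he v tv) fct_sumE.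
  by apply: eq_bigr => j _; rewrite !fctE !mxE.
have tw : tangent z (\sum_s u 0 s *: f s).
  by apply: tangent_sum => s; exact: tangentZ.
exists (\sum_s u 0 s *: f s) => //.
rewrite (he v tv) (he _ (tmap_tangent si tw)); apply: eq_bigr => j _.
congr (_ *: _); have := congr1 (fun X : 'rV_(cdim M) => X 0 j) uE.
rewrite !mxE => ->; rewrite tmap_lincomb fct_sumE.
by apply: eq_bigr => s _; rewrite !fctE mxE.
Qed.

(** The dual of [tangent_level]: the same count with [A] and [B] exchanged puts the coordinates of
    [a] in the row space of [B]. *)
Lemma annihilator_level z a : cotangent (i z) a ->
  (forall w, tangent z w -> a (tmap i z w) = 0) ->
  exists2 xi, lie_alg xi & a = differential (fun y => P y xi) (i z).
Proof.
move=> ca aN.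
have [e [h [f [xi [[te he tf gxi] [fA fB AB]]]]]] := level_frames z.
have /submxP[u uE] : ((\row_j a (e j)) <=
    \matrix_(t, j) e j (fun y => P y (xi t)))%MS.
  apply: (orthogonal_row_space _ fB fA); first by rewrite addnC; exact: level_dim.
    by apply: trmx_inj; rewrite trmx_mul trmxK AB trmx0.
  apply/rowP => s; rewrite !mxE -[RHS](aN _ (tf s)).
  rewrite (he _ (tmap_tangent si (tf s))) (cotangent_sum _ _ ca te).
  by apply: eq_bigr => j _; rewrite !mxE mulrC.
have gx : lie_alg (\sum_t u 0 t *: xi t).
  by apply: tangent_sum => t; apply: tangentZ; exact: gxi.
exists (\sum_t u 0 t *: xi t) => //.
apply: (cotangent_eq ca (differential_cotangent _ _)) => v tv.
rewrite differentialE// {1}(he v tv) (cotangent_sum _ _ ca te).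
rewrite {2}(he v tv) fct_sumE; apply: eq_bigr => j _; rewrite !fctE.
congr (_ * _); rewrite momentum_lincomb//.
rewrite (tangentf_lincomb _ _ (te j)); last first.
  by move=> t; apply/smooth_smooth_near/P_smooth/gxi.
have := congr1 (fun X : 'rV_(cdim M) => X 0 j) uE.
by rewrite !mxE => ->; apply: eq_bigr => t _; rewrite mxE.
Qed.

End level_set.

(** * Reduction *)

Section fields.
Context {R : realType} {M : manifold R}.
Implicit Types (U : set M).

Lemma vfield_lincomb U r (c : 'I_r -> R) (X : 'I_r -> M -> tvec M) :
  open U -> (forall k, vfield U (X k)) ->
  vfield U (fun x => \sum_k c k *: X k x).
Proof.
move=> oU vX; split=> [x Ux|W f oW sf].
  by apply: tangent_sum => k; apply: tangentZ; case: (vX k) => + _; exact.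
rewrite (_ : (fun x => _) = fun x => \sum_k c k * X k x f).
  have oUW := openI oU oW.
  apply: smooth_on_sum => // k; apply: smooth_onM => //.
    exact: smooth_on_cst.
  by case: (vX k) => _; exact.
by apply/funext => x; rewrite fct_sumE.
Qed.

Lemma vfieldB U (X Y : M -> tvec M) : open U -> vfield U X -> vfield U Y ->
  vfield U (fun x => X x - Y x).
Proof.
move=> oU vX vY.
pose XY (k : 'I_2) := if k == 0 then X else Y.
have := @vfield_lincomb U 2 (fun k => if k == 0 then 1 else -1) XY oU.
rewrite (_ : (fun x => \sum_k _) = fun x => X x - Y x).
  by apply=> k; rewrite /XY; case: ifP.
by apply/funext => x; rewrite big_ord_recl big_ord1 /XY/= scale1r scaleN1r.
Qed.

Lemma oneform_lincomb U r (c : 'I_r -> R) (a : 'I_r -> M -> cvec M) :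
  (forall k, oneform U (a k)) -> oneform U (fun x => \sum_k c k *: a k x).
Proof.
move=> va; split=> [x Ux|W X oW WU vX].
  by apply: cotangent_lincomb => k; case: (va k) => + _; exact.
rewrite (_ : (fun x => _) = fun x => \sum_k c k * a k x (X x)).
  apply: smooth_on_sum => // k; apply: smooth_onM => //.
    exact: smooth_on_cst.
  by case: (va k) => _; exact.
by apply/funext => x; rewrite fct_sumE.
Qed.

Lemma fst_lincomb (V W : lmodType R) r (c : 'I_r -> R)
    (s : 'I_r -> (V * W)%type) :
  (\sum_k c k *: s k).1 = \sum_k c k *: (s k).1.
Proof. by rewrite raddf_sum. Qed.

Lemma snd_lincomb (V W : lmodType R) r (c : 'I_r -> R)
    (s : 'I_r -> (V * W)%type) :
  (\sum_k c k *: s k).2 = \sum_k c k *: (s k).2.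
Proof. by rewrite raddf_sum. Qed.

(* The section through a given point has constant coefficients in a frame. *)
Lemma subbundle_section (D : M -> set (tvec M * cvec M)%type) y q :
  subbundle (@pfield R M) D -> D y q ->
  exists U X a, [/\ open U, U y,
    is_section (@pfield R M) D U (fun x => (X x, a x)) & q = (X y, a y)].
Proof.
move=> /(_ y)[U [r [s [oU Uy fs frs]]]] Dq.
have [_ DyE] := frs y Uy; move: Dq; rewrite DyE => /lspan_rangeP[c qE].
exists U, (fun x => \sum_k c k *: (s k x).1), (fun x => \sum_k c k *: (s k x).2).
split=> //; last by rewrite qE -fst_lincomb -snd_lincomb -surjective_pairing.
split=> [|x Ux].
  by split; [apply: vfield_lincomb => // k; case: (fs k)|
             apply: oneform_lincomb => k; case: (fs k)].
have [_ ->] := frs x Ux; apply/lspan_rangeP; exists c.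
by rewrite -fst_lincomb -snd_lincomb -surjective_pairing.
Qed.

(** The covectors annihilate [Delta], so each vector may be replaced by the image under [J] of its
    covector; skewness of [J] then cancels the two terms. *)
Lemma dirac_of_isotropic (J : M -> cvec M -> tvec M)
    (Delta : M -> set (tvec M)) (x : M) q q' :
  skew_bundle_map J -> dirac_of J Delta x q -> dirac_of J Delta x q' ->
  q.2 q'.1 + q'.2 q.1 = 0.
Proof.
move=> [tJ _ skewJ _] [tq cq Dq [_ aq]] [tq' cq' Dq' [_ aq']].
have E (a : cvec M) v w : cotangent x a -> tangent x v -> tangent x w ->
    a (v - w) = 0 -> a v = a w.
  move=> ca tv tw avw; rewrite -[v](subrK w) -[v - w]scale1r.
  by rewrite (cotangentP _ ca)// ?avw ?mulr0 ?add0r//; exact: tangentB.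
have -> : q.2 q'.1 = q.2 (J x q'.2) by apply: E => //; [exact: tJ|exact: aq].
have -> : q'.2 q.1 = q'.2 (J x q.2) by apply: E => //; [exact: tJ|exact: aq'].
by rewrite skewJ// addNr.
Qed.

Lemma skew_map_lincomb (J : M -> cvec M -> tvec M) x r (c : 'I_r -> R)
    (b : 'I_r -> cvec M) : skew_bundle_map J -> (forall k, cotangent x (b k)) ->
  J x (\sum_k c k *: b k) = \sum_k c k *: J x (b k).
Proof.
move=> [_ JP _ _] cb.
have J0 : J x 0 = 0.
  have := JP x 1 0 0 (cotangent_zero x) (cotangent_zero x).
  rewrite !scale1r addr0 => J00.
  by apply: (addrI (J x 0)); rewrite addr0 -J00.
elim: {c b cb}r c b cb => [|r IH] c b cb; first by rewrite !big_ord0.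
rewrite !big_ord_recl JP ?IH//.
exact: cotangent_lincomb.
Qed.

(** Fiberwise both sides agree by definition; what remains is smoothness of [X - J a], as [J] maps
    smooth one-forms to smooth fields. *)
Lemma dirac_of_sections (J : M -> cvec M -> tvec M)
    (Delta : M -> set (tvec M)) U X a :
  skew_bundle_map J -> open U -> vfield U X -> oneform U a ->
  is_section (@pfield R M) (dirac_of J Delta) U (fun x => (X x, a x)) <->
  is_section (@vfield R M) Delta U (fun x => X x - J x (a x)) /\
  is_section (@oneform R M) (annihilator Delta) U a.
Proof.
move=> [_ _ _ sJ] oU vX oa; split=> [[_ Dp]|[[_ DX] [_ Da]]].
  split; split=> //; last by move=> x /Dp[].
    by apply: vfieldB => //; exact: sJ.
  by move=> x /Dp[].
split=> // x Ux; split; [|by case: oa => + _; exact|exact: DX|exact: Da].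
by case: vX => + _; exact.
Qed.

End fields.

(** * Comparison of the two reductions at a point *)

Section reduction.
Context {R : realType} {M : manifold R} {G : lieGroup R} {N M0 : manifold R}.
Context {br : (M -> R) -> (M -> R) -> M -> R} {J : M -> cvec M -> tvec M}.
Context {Delta : M -> set (tvec M)} {act : G -> M -> M} {P : M -> cvec G}.
Context {i : N -> M} {p : N -> M0}.
Context {br0 : (M0 -> R) -> (M0 -> R) -> M0 -> R}.
Context {J0 : M0 -> cvec M0 -> tvec M0} {Delta0 : M0 -> set (tvec M0)}.
Hypothesis br_J : bundle_map_of br J.
Hypothesis P_momentum : momentum_map act (dirac_of J Delta) P.
Hypothesis P_regular : zero_regular_value P.
Hypothesis N_level : zero_level P i.
Hypothesis sp : smooth_map p.
Hypothesis M0_Cinf : forall f0 : M0 -> R, smooth f0 -> singular_Cinf act i p f0.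
Hypothesis br0_reduced : reduced_bracket act i p br br0.
Hypothesis br0_J0 : bundle_map_of br0 J0.
Hypothesis Delta0_reduced : reduced_distribution act i p Delta Delta0.

Let si : smooth_map i. Proof. by case: N_level => -[]. Qed.
Let P_coalg : forall x, lie_coalg (P x). Proof. by case: P_momentum. Qed.
Let P_smooth : forall xi, lie_alg xi -> smooth (fun x => P x xi).
Proof. by case: P_momentum. Qed.

(** The composite of [f] with the orbit map through [x] is constant. *)
Lemma generator_invariant xi x f : lie_alg xi -> smooth f ->
  invariant_fun act f -> generator act xi x f = 0.
Proof.
move=> gxi sf invf; rewrite /generator /tmap; case: ifP => // _.
rewrite (_ : _ \o _ = fun=> f x); first exact: tangent_cst gxi.
by apply/funext => g; exact: invf.
Qed.

(** Both sides apply [w] to one function on [N], as [f0 \o p = f \o i]. Vectors on [M] and on [M0]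
    are compared through this. *)
Lemma tmap_induces z w f f0 : smooth f0 -> induces act i p f f0 ->
  tmap p z w f0 = tmap i z w f.
Proof.
move=> sf0 [sf _ fE]; rewrite !tmapE//; congr (w _).
by apply/funext => z' /=.
Qed.

Lemma momentum_distribution_eq0 x xi v : lie_alg xi -> Delta x v ->
  tangent x v -> v (fun y => P y xi) = 0.
Proof.
case: P_momentum => _ _ _ PD gxi Dv tv.
have [_ /(_ x I) [_ _ _ [_ aD]]] := PD xi gxi.
by rewrite -(differentialE _ tv); exact: aD.
Qed.

(** The inclusion at a single point: [(X, a)] and [(X0, a0)] stand for the values at [i z] and [p z]
    of a section and its reduction, linked by a vector [w] tangent to [N]. *)
Lemma lift_dirac z X0 a0 X a w :
  tangent (p z) X0 -> cotangent (p z) a0 ->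
  dirac_of J Delta (i z) (X, a) -> tangent z w -> tmap i z w = X ->
  tmap p z w = X0 -> cpull i z a = cpull p z a0 ->
  dirac_of J0 Delta0 (p z) (X0, a0).
Proof.
move=> tX0 ca0 [/= tX ca XJa [_ aD]] tw wX wX0 aa0.
have [JM brJ] := br_J; have [tJ JP _ _] := JM.
have [J0M brJ0] := br0_J0; have [tJ0 _ _ _] := J0M.
have [_ br0E] := br0_reduced.
have [U [W [m [Y [Y0 [oU Uz oW [frY prY DE]]]]]]] := Delta0_reduced z.
have [_ DxE] := frY _ Uz.
have prYz k : [/\ tangent (i z) (Y k (i z)), tangent (p z) (Y0 k (p z)) &
    forall f f0, smooth f0 -> induces act i p f f0 ->
      Y k (i z) f = Y0 k (p z) f0].
  case: (prY k) => -[tY _] [tY0 _] /(_ z Uz)[Wz E].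
  split; [exact: tY|exact: tY0|].
  by move=> f f0 sf0; apply: E; exact: M0_Cinf.
have DY k : Delta (i z) (Y k (i z)).
  rewrite DxE; apply/lspan_rangeP; exists (fun l => (l == k)%:R).
  rewrite (bigD1 k)//= eqxx scale1r big1 ?addr0// => l /negbTE ->.
  by rewrite scale0r.
have pulla u : tangent z u -> a (tmap i z u) = a0 (tmap p z u).
  move=> tu; have := congr1 (fun b : cvec N => b u) aa0.
  by rewrite /cpull asboolT.
have a0Y k : a0 (Y0 k (p z)) = 0.
  have [tY tY0 YE] := prYz k.
  have [|u tu uY] := tangent_level P_smooth P_regular N_level tY.
    by move=> xi gxi; exact: momentum_distribution_eq0 (DY k) tY.
  (* The projection of [Y k] is known only through its action on functions of [M0], which suffices
     to identify it with the image of [u]. *)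
  have -> : Y0 k (p z) = tmap p z u.
    apply: (tangent_eq tY0) => [|f0 sf0]; first exact: tmap_tangent.
    have [_ [f fE]] := M0_Cinf sf0.
    by rewrite (tmap_induces _ _ sf0 fE) uY (YE _ _ sf0 fE).
  by rewrite -pulla// uY aD.
split=> //=; last first.
  split=> // v; rewrite DE// => /lspan_rangeP[c ->].
  rewrite (cotangent_sum _ _ ca0); last by move=> k; case: (prYz k).
  by rewrite big1// => k _; rewrite a0Y mulr0.
have [e0 [h0 [te0 sh0 he0 eh0]]] := tangent_basis (p z).
have /choice[h hE] : forall k, exists f, induces act i p f (h0 k).
  by move=> k; case: (M0_Cinf (sh0 k)) => _.
have sh k : smooth (h k) by case: (hE k).
have dh0 k := differential_cotangent (p z) (h0 k).
have dh k := differential_cotangent (i z) (h k).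
pose lam k := a0 (e0 k).
have a0E : a0 = \sum_k lam k *: differential (h0 k) (p z).
  apply: (cotangent_eq ca0); first exact: cotangent_lincomb.
  move=> v tv; rewrite {1}(he0 v tv) (cotangent_sum _ _ ca0 te0) fct_sumE.
  by apply: eq_bigr => k _; rewrite !fctE differentialE// mulrC.
pose b := \sum_k lam k *: differential (h k) (i z).
have cb : cotangent (i z) b by exact: cotangent_lincomb.
have [|xi gxi abE] := annihilator_level P_coalg P_smooth P_regular N_level
    (cotangentB ca cb).
  (* On vectors tangent to [N], [a] is the pullback of [a0], and so is [b] because each [h k]
     restricts to the pullback of [h0 k]. *)
  move=> u tu; rewrite !fctE pulla// a0E /b !fct_sumE.
  apply/eqP; rewrite subr_eq0; apply/eqP; apply: eq_bigr => k _.
  rewrite !fctE !differentialE; [|exact: tmap_tangent..].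
  by rewrite (tmap_induces _ _ (sh0 k) (hE k)).
have [_ _ _ /(_ xi gxi)[_ /(_ (i z) I)[/= tg _ gD _]]] := P_momentum.
move: XJa gD; rewrite DxE => /lspan_rangeP[c1 XJa] /lspan_rangeP[c2 gD].
(* [c1] and [c2] are the coordinates of [X - J a] and of [xi_M - J dP_xi] in the frame [Y]. As
   [a - b = dP_xi], their difference is what remains of [X - J b] after removing [xi_M]. *)
rewrite DE//; apply/lspan_rangeP; exists (fun k => c1 k - c2 k).
have tsum : tangent (p z) (\sum_k (c1 k - c2 k) *: Y0 k (p z)).
  by apply: tangent_sum => k; apply: tangentZ; case: (prYz k).
apply: (tangent_eq _ tsum) => [|f0 sf0].
  by apply: tangentB => //; exact: tJ0.
have [_ [f fE]] := M0_Cinf sf0; have [sf invf _] := fE.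
have Jab : J (i z) a = J (i z) b +
    J (i z) (differential (fun y => P y xi) (i z)).
  rewrite -abE addrC -[a - b]scale1r.
  have := JP (i z) 1 (a - b) b (cotangentB ca cb) cb.
  by rewrite !scale1r subrK.
have XJb : X - J (i z) b = \sum_k (c1 k - c2 k) *: Y k (i z) +
    generator act xi (i z).
  rewrite (eq_bigr _ (fun k _ => scalerBl _ _ _)) sumrB -XJa -gD Jab.
  by rewrite opprB -[RHS]addrA subrK opprD addrA subrK.
(* Both sides expand into sums of the brackets [br0 f0 (h0 k)] and [br f (h k)] with the same
   coefficients [lam k], and the reduced bracket equates them term by term. *)
have bracketE : (J0 (p z) a0) f0 = (J (i z) b) f.
  rewrite a0E (skew_map_lincomb _ J0M dh0) (skew_map_lincomb _ JM dh).
  rewrite !fct_sumE; apply: eq_bigr => k _; rewrite !fctE; congr (_ * _).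
  rewrite -(differentialE f0 (tJ0 _ _ (dh0 k))) brJ0//.
  rewrite -(differentialE f (tJ _ _ (dh k))) brJ//.
  by apply: br0E => //; exact: M0_Cinf.
transitivity ((X - J (i z) b) f).
  rewrite [LHS]/(X0 f0 - J0 (p z) a0 f0) bracketE -wX0 (tmap_induces _ _ sf0 fE).
  by rewrite wX.
rewrite XJb fctE (generator_invariant _ gxi sf invf) addr0.
rewrite !fct_sumE; apply: eq_bigr => k _; rewrite !fctE.
by case: (prYz k) => _ _ /(_ _ _ sf0 fE) ->.
Qed.

End reduction.

(** * Equality of the two reduced Dirac structures *)

Theorem mainTheorem2 (R : realType)
    (M : manifold R)
    (br : (M -> R) -> (M -> R) -> M -> R)
    (J : M -> cvec M -> tvec M)
    (Delta : M -> set (tvec M))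
    (G : lieGroup R) (act : G -> M -> M)
    (P : M -> cvec G)
    (N : manifold R) (i : N -> M)
    (M0 : manifold R) (p : N -> M0)
    (Dhat : M0 -> set (tvec M0 * cvec M0)%type)
    (br0 : (M0 -> R) -> (M0 -> R) -> M0 -> R)
    (J0 : M0 -> cvec M0 -> tvec M0)
    (Delta0 : M0 -> set (tvec M0))
    (br_poisson : gen_poisson br)
    (br_J : bundle_map_of br J)
    (Delta_bundle : subbundle (@vfield R M) Delta)
    (act_smooth : smooth_action act)
    (act_symmetry : symmetry act J Delta)
    (P_momentum : momentum_map act (dirac_of J Delta) P)
    (VDelta_dim : const_dim (fun x => set_add (vertical act x) (Delta x)))
    (P_regular : zero_regular_value P)
    (act_regular : regular_action act)
    (N_level : zero_level P i)
    (M0_quotient :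
       smooth_quotient (fun z z' => exists g, i z' = act g (i z)) p)
    (M0_Cinf : forall f0 : M0 -> R, smooth f0 <-> singular_Cinf act i p f0)
    (reg_conditions : regular_conditions i p (dirac_of J Delta))
    (Dhat_reduced : regular_reduced i p (dirac_of J Delta) Dhat)
    (br0_reduced : reduced_bracket act i p br br0)
    (br0_J0 : bundle_map_of br0 J0)
    (Delta0_reduced : reduced_distribution act i p Delta Delta0) :
  [/\ dirac_structure (dirac_of J0 Delta0),
      (forall (W : set M0) X0 a0, open W -> vfield W X0 -> oneform W a0 ->
         (is_section (@pfield R M0) (dirac_of J0 Delta0) W
            (fun y => (X0 y, a0 y)) <->
          is_section (@vfield R M0) Delta0 W
            (fun y => X0 y - J0 y (a0 y)) /\
          is_section (@oneform R M0) (annihilator Delta0) W a0)) &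
      Dhat = dirac_of J0 Delta0].
Proof.
have [sub_p surj_p _] := M0_quotient; have [sp _] := sub_p.
have smooth_sing f0 : smooth f0 -> singular_Cinf act i p f0.
  by case: (M0_Cinf f0).
have [J0M _] := br0_J0.
have [[Dhat_bundle Dhat_orth] Dhat_lifts] := Dhat_reduced.
have Dhat_sub y q : Dhat y q -> dirac_of J0 Delta0 y q.
  move=> /(subbundle_section Dhat_bundle)[W [X0 [a0 [oW Wy secW ->]]]].
  have [[vX0 oa0] _] := secW.
  (* [Dhat] is described through its local sections, so the element is first extended to one; its
     lift provides the point [z] over [y]. *)
  have /(_ y Wy) := (Dhat_lifts W X0 a0 oW vX0 oa0).1 secW.
  move=> [U [X [a [oU [z Uz pz] [_ DXa] lift]]]]; subst y.
  have [[w [tw wX wX0]] aa0] := lift z Uz Wy.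
  apply: (lift_dirac br_J P_momentum P_regular N_level sp smooth_sing
    br0_reduced br0_J0 Delta0_reduced _ _ (DXa _ Uz) tw wX wX0 aa0).
    by case: vX0 => + _; exact.
  by case: oa0 => + _; exact.
have DhatE : Dhat = dirac_of J0 Delta0.
  apply/funext => y; apply/seteqP; split=> q; first exact: Dhat_sub.
  (* An element of the larger isotropic fiber is orthogonal to all of [Dhat y], hence belongs to it
     by maximality. *)
  move=> Dq; rewrite Dhat_orth; have [tq cq _ _] := Dq; split=> // q' Dq'.
  exact: dirac_of_isotropic J0M Dq (Dhat_sub _ _ Dq').
split=> //; first by rewrite -DhatE; case: Dhat_reduced.
by move=> W X0 a0 oW vX0 oa0; exact: dirac_of_sections.
Qed.
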